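(* Let $S$ be a compact, connected, non-positively curved special cube complex, $\Gamma$ its fundamental group, and $X$ its universal covering. Suppose $\Gamma$ acts vertex-transitively on $X$ and suppose the $1$-skeleton of $\mathrm{lk}(X)$ is flexibly vertex-transitive. Then $\overline{\mathrm{Aut}^+(X)}$ has finite index in $\mathrm{Aut}(X)$.
   Context: $\mathrm{Aut}(X)$ is the group of cubical automorphisms of the CAT(0) cube complex $X$ with the compact-open topology. $\mathrm{Aut}^+(X)$ is the subgroup of $\mathrm{Aut}(X)$ generated by all elements that fix some halfspace of $X$ pointwise, and $\overline{\mathrm{Aut}^+(X)}$ is its closure in $\mathrm{Aut}(X)$. ''Special'' is in the sense of Haglund--Wise (hyperplanes are embedded and two-sided, do not directly self-osculate, and do not inter-osculate). Since $\Gamma$ acts vertex-transitively, the links of all vertices of $X$ are isomorphic; $\mathrm{lk}(X)$ denotes the link of any vertex. (Its vertices are the edges of $X$ starting at the given vertex, and two of them are adjacent iff they span a square.) A graph $L$ is flexibly vertex-transitive if for all vertices $v,w$ of $L$ there exist a vertex $u$ of $L$ and a graph automorphism $\varphi\in\mathrm{Aut}(L)$ such that $\varphi$ fixes $u$ and all neighbours of $u$, and $\varphi(v)=w$. *)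

(* Defs.v *)
From Stdlib Require List.
From Stdlib Require Import Relation_Operators.
From HB Require Import structures.
From mathcomp Require Import all_boot all_order all_algebra.
From mathcomp Require Import generic_quotient.
From mathcomp Require Import all_classical all_reals all_analysis.
Set Implicit Arguments.
Unset Strict Implicit.
Unset Printing Implicit Defensive.
Import Order.TTheory GRing.Theory Num.Theory.
Import numFieldNormedType.Exports.

Local Open Scope classical_set_scope.
Local Open Scope ring_scope.

(** * Cube complexes *)

(* A [face_map m n] is an isometry from [0,1]^m onto an m-dimensional face of
   [0,1]^n.  The k-th coordinate of the image of t is
     b            if the k-th entry is (None, b),
     t_i          if it is (Some i, false),
     1 - t_i      if it is (Some i, true),
   and every coordinate t_i is used exactly once. *)
Definition face_map_spec m n (f : {ffun 'I_n -> option 'I_m * bool}) : bool :=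
  [forall i : 'I_m, #|[pred k | (f k).1 == Some i]| == 1%N].

Record face_map m n := FaceMap {
  face_coord :> {ffun 'I_n -> option 'I_m * bool};
  face_coordP : face_map_spec face_coord
}.

HB.instance Definition _ m n := [isSub for @face_coord m n].
HB.instance Definition _ m n := [Equality of face_map m n by <:].

Lemma face_map_specI m n (f : {ffun 'I_n -> option 'I_m * bool}) :
  (forall i, exists k, forall l, ((f l).1 == Some i) = (l == k)) ->
  face_map_spec f.
Proof.
move=> fP; apply/forallP => i; have [k fk] := fP i.
by apply/eqP; rewrite -[RHS](card1 k); apply: eq_card => l; rewrite !inE fk.
Qed.

Lemma face_id_subproof n :
  face_map_spec [ffun k : 'I_n => (Some k, false)].
Proof. by apply: face_map_specI => i; exists i => k; rewrite ffunE. Qed.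

Definition face_id n : face_map n n := FaceMap (face_id_subproof n).

Definition comp_coord m n (f : face_map m n) (a : option 'I_n * bool) :
    option 'I_m * bool :=
  if a.1 is Some j then ((f j).1, (f j).2 (+) a.2) else (None, a.2).

Lemma face_comp_subproof m n p (g : face_map n p) (f : face_map m n) :
  face_map_spec [ffun k : 'I_p => comp_coord f (g k)].
Proof.
apply: face_map_specI => i.
have /eqP/mem_card1[j fj] := forallP (face_coordP f) i.
have /eqP/mem_card1[k gk] := forallP (face_coordP g) j.
exists k => l.
have := gk l; rewrite !inE ffunE /comp_coord => <-.
case: (g l).1 => [j'|] //=; have := fj j'; rewrite !inE => ->.
by apply/eqP/eqP => [->|[->]].
Qed.

(* [face_comp g f] is g after f. *)
Definition face_comp m n p (g : face_map n p) (f : face_map m n) :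
  face_map m p := FaceMap (face_comp_subproof g f).

(* A cube complex, i.e. a collection of unit cubes glued along their faces by
   isometries, is given by its parametrized cubes: [cell n] is the set of all
   characteristic maps of n-cubes (so that an n-cube accounts for the 2^n n!
   elements of [cell n] obtained by precomposing with the isometries of
   [0,1]^n), and [face f c] is the characteristic map c precomposed with f.
   [face_free] says that only boundary faces are glued: no cube is folded onto
   itself.  Several faces of one cube may be identified, so that for instance
   complexes with a single vertex are allowed. *)
Record cube_complex := CubeComplex {
  cell : nat -> Type;
  face : forall m n, face_map m n -> cell n -> cell m;
  face_idE : forall n (c : cell n), face (face_id n) c = c;
  face_compE : forall m n p (g : face_map n p) (f : face_map m n) (c : cell p),
    face (face_comp g f) c = face f (face g c);
  face_free : forall n (f : face_map n n) (c : cell n),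
    face f c = c -> f = face_id n
}.

Arguments face {_ m n}.

Lemma corner_subproof n (w : 'I_n -> bool) :
  face_map_spec [ffun k : 'I_n => (None : option 'I_0, w k)].
Proof. by apply: face_map_specI => -[]. Qed.

(* The vertex w of the n-cube. *)
Definition corner_map n (w : 'I_n -> bool) : face_map 0 n :=
  FaceMap (corner_subproof w).

Lemma edge_subproof n (i : 'I_n) (w : 'I_n -> bool) :
  face_map_spec [ffun k : 'I_n =>
    if k == i then (Some (ord0 : 'I_1), false) else (None, w k)].
Proof.
apply: face_map_specI => j; exists i => k.
by rewrite ffunE (ord1 j); case: (k == i).
Qed.

(* The edge of the n-cube in direction i whose other coordinates are given
   by w, oriented from t_i = 0 to t_i = 1. *)
Definition edge_map n (i : 'I_n) (w : 'I_n -> bool) : face_map 1 n :=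
  FaceMap (edge_subproof i w).

Lemma flip_subproof :
  face_map_spec [ffun _ : 'I_1 => (Some (ord0 : 'I_1), true)].
Proof.
by apply: face_map_specI => i; exists ord0 => k; rewrite ffunE !ord1.
Qed.

Definition flip_map : face_map 1 1 := FaceMap flip_subproof.

Section CubeComplexTheory.
Variable X : cube_complex.

(* Elements of [cell X 0] are the vertices of X and elements of [cell X 1] its
   oriented edges. *)
Definition corner n (c : cell X n) (w : 'I_n -> bool) : cell X 0 :=
  face (corner_map w) c.

Definition base n (c : cell X n) : cell X 0 := corner c (fun=> false).

Definition axis n (c : cell X n) (i : 'I_n) : cell X 1 :=
  face (edge_map i (fun=> false)) c.

Definition source (e : cell X 1) : cell X 0 := corner e (fun=> false).
Definition target (e : cell X 1) : cell X 0 := corner e (fun=> true).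
Definition reverse (e : cell X 1) : cell X 1 := face flip_map e.

Definition bottom_edge (s : cell X 2) : cell X 1 :=
  face (edge_map ord0 (fun=> false)) s.
Definition top_edge (s : cell X 2) : cell X 1 :=
  face (edge_map ord0 (fun=> true)) s.
Definition left_edge (s : cell X 2) : cell X 1 :=
  face (edge_map ord_max (fun=> false)) s.
Definition right_edge (s : cell X 2) : cell X 1 :=
  face (edge_map ord_max (fun=> true)) s.

Definition compact_complex : Prop := finite_set [set: {n & cell X n}].

(** ** Links and non-positive curvature *)

(* The vertices of the link of v are the oriented edges with source v, and the
   n-cubes c with base v are its (ordered) (n-1)-simplices, with vertices
   [axis c i]. *)
Definition span_square (a b : cell X 1) : Prop :=
  exists s : cell X 2, bottom_edge s = a /\ left_edge s = b.

Definition links_simplicial : Prop :=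
  (forall n (c : cell X n), injective (axis c)) /\
  (forall n (c c' : cell X n),
    base c = base c' -> (forall i, axis c i = axis c' i) -> c = c').

Definition links_flag : Prop :=
  forall n (v : cell X 0) (a : 'I_n -> cell X 1),
    injective a ->
    (forall i, source (a i) = v) ->
    (forall i j, i != j -> span_square (a i) (a j)) ->
    exists c : cell X n, base c = v /\ forall i, axis c i = a i.

Definition nonpositively_curved : Prop := links_simplicial /\ links_flag.

Definition link_vertex (v : cell X 0) : Type := {e : cell X 1 | source e = v}.

Definition link_adj (v : cell X 0) (a b : link_vertex v) : Prop :=
  span_square (proj1_sig a) (proj1_sig b).

(** ** Edge paths and the fundamental group *)

Fixpoint edge_path (v : cell X 0) (q : seq (cell X 1)) (w : cell X 0) : Prop :=
  if q is e :: q' then source e = v /\ edge_path (target e) q' w else v = w.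

Definition connected_complex : Prop :=
  (exists v : cell X 0, True) /\
  forall v w : cell X 0, exists q, edge_path v q w.

Variant elementary_homotopy : seq (cell X 1) -> seq (cell X 1) -> Prop :=
| HBacktrack q r e :
    elementary_homotopy (q ++ [:: e; reverse e] ++ r) (q ++ r)
| HSquare q r s :
    elementary_homotopy (q ++ [:: bottom_edge s; right_edge s] ++ r)
                        (q ++ [:: left_edge s; top_edge s] ++ r).

(* Homotopy relative to the endpoints of edge paths from v to w. *)
Definition homotopic (v w : cell X 0) : seq (cell X 1) -> seq (cell X 1) -> Prop :=
  clos_refl_sym_trans _ (fun q r =>
    [/\ edge_path v q w, edge_path v r w & elementary_homotopy q r]).

Definition simply_connected : Prop :=
  connected_complex /\
  forall v q, edge_path v q v -> homotopic v v q [::].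

(** ** Hyperplanes *)

Definition oparallel : cell X 1 -> cell X 1 -> Prop :=
  clos_refl_sym_trans _ (fun a b => exists s, a = bottom_edge s /\ b = top_edge s).

(* A hyperplane is identified with the set of (oriented) edges dual to it. *)
Definition hyperplane (e : cell X 1) : set (cell X 1) :=
  [set a | oparallel e a \/ oparallel e (reverse a)].

Definition is_hyperplane (H : set (cell X 1)) : Prop :=
  exists e, H = hyperplane e.

Definition cross (H K : set (cell X 1)) : Prop :=
  exists a b, [/\ H a, K b & span_square a b].

Definition osculate (H K : set (cell X 1)) : Prop :=
  exists a b, [/\ H a, K b, source a = source b & ~ span_square a b].

Definition embedded_hyperplane (H : set (cell X 1)) : Prop := ~ cross H H.

Definition two_sided_hyperplane (H : set (cell X 1)) : Prop :=
  forall a, H a -> ~ oparallel a (reverse a).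

(* Osculation at terminal vertices is covered by replacing a and b by their
   reverses. *)
Definition directly_self_osculates (H : set (cell X 1)) : Prop :=
  exists a b, [/\ H a, H b & oparallel a b] /\
    [/\ source a = source b, a <> b & ~ span_square a b].

Definition inter_osculate (H K : set (cell X 1)) : Prop :=
  [/\ H <> K, cross H K & osculate H K].

Definition special : Prop :=
  (forall H, is_hyperplane H ->
    [/\ embedded_hyperplane H, two_sided_hyperplane H
      & ~ directly_self_osculates H]) /\
  (forall H K, is_hyperplane H -> is_hyperplane K -> ~ inter_osculate H K).

(** ** Halfspaces *)

(* The vertex sets of the connected components of X minus the hyperplane H. *)
Definition side (H : set (cell X 1)) (v : cell X 0) : set (cell X 0) :=
  [set w | exists q, edge_path v q w /\ List.Forall (fun e => ~ H e) q].

Definition is_halfspace (h : set (cell X 0)) : Prop :=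
  exists H v, is_hyperplane H /\ h = side H v.

End CubeComplexTheory.

Arguments link_adj {X} v a b.

(** * Flexibly vertex-transitive graphs *)

Section Graphs.
Variables (V : Type) (adj : V -> V -> Prop).

Definition graph_automorphism (phi : V -> V) : Prop :=
  bijective phi /\ forall a b, adj (phi a) (phi b) <-> adj a b.

Definition flexibly_vertex_transitive : Prop :=
  forall v w, exists u phi,
    [/\ graph_automorphism phi, phi u = u,
        forall n, adj u n -> phi n = n & phi v = w].

End Graphs.

(** * Maps, coverings and automorphisms *)

Record cube_map (X Y : cube_complex) := CubeMap {
  cmap :> forall n, cell X n -> cell Y n;
  cmap_face : forall m n (f : face_map m n) (c : cell X n),
    cmap (face f c) = face f (cmap c)
}.

Lemma cube_mapP X Y (p q : cube_map X Y) :
  (forall n (c : cell X n), p n c = q n c) -> p = q.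
Proof.
case: p q => [p pP] [q qP] /= pq.
have epq : p = q by apply: functional_extensionality_dep => n; apply/funext.
by rewrite -epq in qP *; rewrite (Prop_irrelevance pP qP).
Qed.

Definition covering X S (p : cube_map X S) : Prop :=
  forall (x : cell X 0) n (c : cell S n), base c = p _ x ->
    exists! c' : cell X n, base c' = x /\ p _ c' = c.

Definition universal_covering X S (p : cube_map X S) : Prop :=
  simply_connected X /\ covering p.

Lemma cid_map_subproof X m n (f : face_map m n) (c : cell X n) :
  face f c = face f c.
Proof. by []. Qed.

Definition id_map X : cube_map X X :=
  @CubeMap X X (fun n c => c) (@cid_map_subproof X).

Lemma comp_map_subproof X Y Z (q : cube_map Y Z) (p : cube_map X Y)
    m n (f : face_map m n) (c : cell X n) :
  q _ (p _ (face f c)) = face f (q _ (p _ c)).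
Proof. by rewrite !cmap_face. Qed.

Definition comp_map X Y Z (q : cube_map Y Z) (p : cube_map X Y) : cube_map X Z :=
  @CubeMap X Z (fun n c => q n (p n c)) (@comp_map_subproof X Y Z q p).

Record cube_aut (X : cube_complex) := CubeAut {
  aut_map :> cube_map X X;
  aut_inv : cube_map X X;
  autK : forall n, cancel (aut_map n) (aut_inv n);
  autVK : forall n, cancel (aut_inv n) (aut_map n)
}.

Section AutGroup.
Variable X : cube_complex.
Implicit Types g h : cube_aut X.

Lemma cube_autP g h : (forall n (c : cell X n), g n c = h n c) -> g = h.
Proof.
move=> gh; have inv_gh : aut_inv g = aut_inv h.
  by apply: cube_mapP => n c; rewrite -{1}(autVK h c) -gh autK.
case: g h {gh} (cube_mapP gh) inv_gh => [g g' gK gVK] [h h' hK hVK] /= e e'.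
rewrite -e -e' in hK hVK *.
by rewrite (Prop_irrelevance gK hK) (Prop_irrelevance gVK hVK).
Qed.

Definition aut_one : cube_aut X :=
  @CubeAut X (id_map X) (id_map X) (fun n c => erefl) (fun n c => erefl).

Definition aut_invg g : cube_aut X := CubeAut (@autVK X g) (@autK X g).

Lemma aut_mulK g h n :
  cancel (comp_map g h n) (comp_map (aut_inv h) (aut_inv g) n).
Proof. by move=> c /=; rewrite !autK. Qed.

Lemma aut_mulVK g h n :
  cancel (comp_map (aut_inv h) (aut_inv g) n) (comp_map g h n).
Proof. by move=> c /=; rewrite !autVK. Qed.

(* [aut_mul g h] is g after h. *)
Definition aut_mul g h : cube_aut X := CubeAut (aut_mulK g h) (aut_mulVK g h).

HB.instance Definition _ := gen_eqMixin (cube_aut X).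
HB.instance Definition _ := gen_choiceMixin (cube_aut X).

Lemma aut_mulA : associative aut_mul.
Proof. by move=> g h k; apply: cube_autP. Qed.
Lemma aut_mul1 : left_id aut_one aut_mul.
Proof. by move=> g; apply: cube_autP. Qed.
Lemma aut_mulr1 : right_id aut_one aut_mul.
Proof. by move=> g; apply: cube_autP. Qed.
Lemma aut_mulV : left_inverse aut_one aut_invg aut_mul.
Proof. by move=> g; apply: cube_autP => n c /=; rewrite autK. Qed.
Lemma aut_mulrV : right_inverse aut_one aut_invg aut_mul.
Proof. by move=> g; apply: cube_autP => n c /=; rewrite autVK. Qed.

HB.instance Definition _ := isGroup.Build (cube_aut X)
  aut_mulA aut_mul1 aut_mulr1 aut_mulV aut_mulrV.

End AutGroup.

(* The fundamental group of S acts on the universal covering X of S as the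
   group of deck transformations. *)
Definition deck_group X S (p : cube_map X S) : set (cube_aut X) :=
  [set g | forall n (c : cell X n), p _ (g _ c) = p _ c].

Definition vertex_transitive X (G : set (cube_aut X)) : Prop :=
  forall x y : cell X 0, exists2 g, G g & g _ x = y.

(** * The compact-open topology on Aut(X) *)

Section Realization.
Variables (R : realType) (X : cube_complex).

Definition unit_cube n : Type :=
  [set t : 'rV[R]_n | forall i, 0 <= t ord0 i <= 1].

HB.instance Definition _ n := Topological.on (unit_cube n).

Definition cubes : Type := {n & cell X n}.
HB.instance Definition _ := gen_eqMixin cubes.
HB.instance Definition _ := gen_choiceMixin cubes.

Definition cubes_union : Type := {c : cubes & unit_cube (projT1 c)}.
HB.instance Definition _ := Topological.on cubes_union.

Definition cube_point n (c : cell X n) (t : unit_cube n) : cubes_union :=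
  existT (fun c : cubes => unit_cube (projT1 c)) (existT (cell X) n c) t.

Definition face_point m n (f : face_map m n) (t : 'rV[R]_m) : 'rV[R]_n :=
  \row_k (if (f k).1 is Some i
          then (if (f k).2 then 1 - t ord0 i else t ord0 i)
          else (f k).2%:R).

Definition glue (x y : cubes_union) : Prop :=
  exists m n (f : face_map m n) (c : cell X n) (t : unit_cube m) (s : unit_cube n),
    [/\ set_val s = face_point f (set_val t),
        x = cube_point (face f c) t & y = cube_point c s].

Definition glued (x y : cubes_union) : bool :=
  `[< clos_refl_sym_trans _ glue x y >].

Lemma glued_refl : reflexive glued.
Proof. by move=> x; apply/asboolP/rst_refl. Qed.

Lemma glued_sym : symmetric glued.
Proof.
by move=> x y; apply/asboolP/asboolP => xy; apply: rst_sym.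
Qed.

Lemma glued_trans : transitive glued.
Proof.
move=> y x z /asboolP xy /asboolP yz; apply/asboolP; exact: rst_trans xy yz.
Qed.

Canonical glued_equiv := EquivRel glued glued_refl glued_sym glued_trans.

Definition realization : Type := quotient_topology {eq_quot glued_equiv}%qT.
HB.instance Definition _ := Topological.on realization.

Local Open Scope quotient_scope.

Definition point_class (x : cubes_union) : realization :=
  \pi_({eq_quot glued_equiv}) x.

Definition aut_point (g : cube_aut X) (x : cubes_union) : cubes_union :=
  cube_point (g _ (projT2 (projT1 x))) (projT2 x).

Definition aut_realization (g : cube_aut X) :
    {compact-open, realization -> realization} :=
  fun x => point_class (aut_point g (repr (x : {eq_quot glued_equiv}))).

Lemma aut_realizationE g x :
  aut_realization g (point_class x) = point_class (aut_point g x).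
Proof.
rewrite /aut_realization; apply/eqquotP.
have : (repr (\pi_({eq_quot glued_equiv}) x) =
        x %[mod {eq_quot glued_equiv}])%qT by rewrite reprK.
move/eqquotP; rewrite -[repr _]/(repr (point_class x : {eq_quot glued_equiv})).
move: (repr _) => y /asboolP.
move=> xy; apply/asboolP; elim: xy => {x y}.
- move=> _ _ [m [n [f [c [t [s [st -> ->]]]]]]]; apply: rst_step.
  exists m, n, f, (g _ c), t, s; split=> //.
  by rewrite -cmap_face.
- by move=> x; apply: rst_refl.
- by move=> x y _; apply: rst_sym.
- by move=> x y z _ xy _; apply: rst_trans.
Qed.

Definition aut_space : Type := initial_topology aut_realization.
HB.instance Definition _ := Topological.on aut_space.

Definition aut_closure (G : set (cube_aut X)) : set (cube_aut X) :=
  closure (G : set aut_space).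

End Realization.

(** * The group generated by the automorphisms fixing a halfspace *)

(* Fixing a parametrized cube means fixing all of its points.  A halfspace is
   regarded here as the full subcomplex on its vertices.  In a CAT(0) cube
   complex an automorphism fixing this subcomplex pointwise fixes all cubes
   crossed by the bounding hyperplane, so that one gets the same group from
   the components of the complement of the hyperplane. *)
Definition fixes_pointwise X (g : cube_aut X) (h : set (cell X 0)) : Prop :=
  forall n (c : cell X n), (forall w, h (corner c w)) -> g _ c = c.

Definition generated_subgroup (G : groupType) (A : set G) : set G :=
  smallest [set H : set G | group_closed [in H]] A.

Definition aut_plus X : set (cube_aut X) :=
  generated_subgroup [set g | exists2 h, is_halfspace h & fixes_pointwise g h].

Arguments aut_plus X : clear implicits.

Definition finite_index (G : groupType) (H : set G) : Prop :=
  finite_set [set [set (g * h)%g | h in H] | g in [set: G]].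

(* Main.v *)
(** The complex S has a single vertex, and specialness forces opposite edges of
its squares to coincide: S is the Salvetti complex of a right-angled Artin
group, and every edge of X carries a letter.  An automorphism g of X acts on
the link of each vertex z by an automorphism phi z of the graph L of letters;
phi (z a) and phi z agree on the star of the letter a, up to replacing a by its
inverse, and since X is simply connected, every such family comes from an
automorphism.

An automorphism of L fixing the star of a letter u thus extends, across the
hyperplane dual to the edge u at y, to an automorphism of X fixing a halfspace
pointwise.  By flexibility, Aut^+(X) is then transitive on the link of every
vertex, so that it has at most two orbits of vertices.  If g fixes the star of
x, it is corrected vertex by vertex, on larger and larger balls around x, by
such elements: at a vertex y of a sphere the action of g on the link fixes the
stars of all edges leading back to x, and the corresponding hyperplanes
separate y from the rest of the ball.  Hence the stabiliser of the star of x
lies in the closure of Aut^+(X), and a coset of the closure is determined by an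
orbit of vertices and the action of a representative on one link. *)

From Stdlib Require List.
From Stdlib Require Import Relation_Operators.
Require Import Defs.
From mathcomp Require Import all_boot all_order all_algebra.
From mathcomp Require Import generic_quotient.
From mathcomp Require Import all_classical all_reals all_analysis.
Set Implicit Arguments.
Unset Strict Implicit.
Unset Printing Implicit Defensive.
Import GRing.Theory Num.Theory.
Import numFieldNormedType.Exports.

Local Open Scope classical_set_scope.

(** * Hyperplanes and geodesics in the universal cover of a Salvetti complex *)

(* The 1-skeleton of the universal cover, with edges labelled by letters;
   [transport] expresses that the squares make it simply connected. *)
Record labelled_cover := LabelledCover {
  vert : Type;
  letter : Type;
  bar : letter -> letter;
  adj : letter -> letter -> Prop;
  step : vert -> letter -> vert;
  barK : involutive bar;
  adj_sym : forall a b, adj a b -> adj b a;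
  adj_bar : forall a b, adj a b -> adj a (bar b);
  adj_irr : forall a, ~ adj a a;
  stepK : forall z a, step (step z a) (bar a) = z;
  step_comm : forall z a b, adj a b -> step (step z a) b = step (step z b) a;
  transport : forall (T : Type) (act : T -> letter -> T),
    (forall s a, act (act s a) (bar a) = s) ->
    (forall s a b, adj a b -> act (act s a) b = act (act s b) a) ->
    forall x s, exists F : vert -> T,
      F x = s /\ forall z a, F (step z a) = act (F z) a;
  vert_connected : forall x y, exists w, foldl step x w = y
}.

Section Words.
Variable C : labelled_cover.
Local Notation V := (vert C).
Local Notation E := (letter C).
Local Notation adj := (@adj C).
Local Notation bar := (@bar C).
Local Notation step := (@step C).
Local Notation walk := (foldl step).
Implicit Types (x y z : V) (a b c s : E) (u v w : seq E).

Lemma stepVK z a : step (step z (bar a)) a = z.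
Proof. by rewrite -{2}(barK a) stepK. Qed.

Lemma adj_barl a b : adj a b -> adj (bar a) b.
Proof. by move=> ab; apply/adj_sym/adj_bar/adj_sym. Qed.

Lemma adj_barlE a b : adj (bar a) b <-> adj a b.
Proof. by split=> [/adj_barl|/adj_barl//]; rewrite barK. Qed.

Lemma adj_neq a b : adj a b -> b <> a /\ b <> bar a.
Proof.
move=> ab; split=> e; move: ab; rewrite e; first exact: adj_irr.
by move=> /adj_bar; rewrite barK; exact: adj_irr.
Qed.

Lemma vert_ind x (P : V -> Prop) :
  P x -> (forall z a, P z -> P (step z a)) -> forall z, P z.
Proof.
move=> Px PS z; have [w <-] := vert_connected x z.
by elim: w x Px => //= a w IH x Px; apply/IH/PS.
Qed.

(* The edges with label [a] starting at [z] and [z'] are opposite sides of a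
   strip of squares, so that they are dual to the same hyperplane. *)
Definition ladder a z z' : Prop :=
  exists2 w, List.Forall (adj a) w & walk z w = z'.

Lemma ladder_refl a z : ladder a z z. Proof. by exists [::]. Qed.

Lemma ladder_trans a y x z : ladder a x y -> ladder a y z -> ladder a x z.
Proof.
move=> [u ua <-] [w wa <-]; exists (u ++ w); last by rewrite foldl_cat.
by apply/List.Forall_app.
Qed.

Lemma ladder_step a b z : adj a b -> ladder a z (step z b).
Proof. by move=> ab; exists [:: b] => //; constructor. Qed.

Lemma ladder_ind a (P : V -> Prop) z :
  P z -> (forall y b, adj a b -> P y -> P (step y b)) ->
  forall z', ladder a z z' -> P z'.
Proof.
move=> Pz PS z' [w wa <-]; elim: w z Pz wa => //= b w IH z Pz wa.
by apply: IH; [apply: PS => //|]; inversion wa.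
Qed.

Lemma ladder_sym a z z' : ladder a z z' -> ladder a z' z.
Proof.
elim/ladder_ind=> [|y b ab yz]; first exact: ladder_refl.
apply: ladder_trans yz; rewrite -{2}(stepK y b).
exact/ladder_step/adj_bar.
Qed.

Lemma ladder_bar a z z' : ladder (bar a) z z' <-> ladder a z z'.
Proof.
by split=> -[w wa e]; exists w => //; apply: List.Forall_impl wa => b /adj_barlE.
Qed.

Lemma ladder_cross a z z' : ladder a z z' -> ladder a (step z a) (step z' a).
Proof.
elim/ladder_ind=> [|y b ab yz]; first exact: ladder_refl.
by apply: ladder_trans yz _; rewrite -step_comm //; apply: ladder_step.
Qed.

(* Deleting the letters that do not commute with [a] respects the relations of
   the group, and it fixes the word of the ladder. *)
Lemma ladder_filter a z z' u : ladder a z z' -> walk z u = z' ->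
  walk z [seq b <- u | `[< adj a b >]] = z'.
Proof.
pose act y b := if `[< adj a b >] then step y b else y.
have act_walk w y : foldl act y w = walk y [seq b <- w | `[< adj a b >]].
  by elim: w y => //= b w IH y; rewrite {2}/act; case: ifP => _ /=; exact: IH.
have act_bar y b : act (act y b) (bar b) = y.
  rewrite /act; case: (asboolP (adj a b)) => ab.
    by rewrite asboolT ?stepK //; apply: adj_bar.
  by rewrite asboolF // => /adj_bar; rewrite barK.
have act_comm y b c : adj b c -> act (act y b) c = act (act y c) b.
  by rewrite /act; do 2 case: ifP => _ //; move=> *; apply: step_comm.
have [F [Fz FS]] := transport act_bar act_comm z z.
have Fwalk w : F (walk z w) = foldl act z w.
  rewrite -{2}Fz; elim: w {Fz} z => //= b w IH y.
  by rewrite IH FS.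
move=> [w wa <-] uw; rewrite -act_walk -Fwalk uw Fwalk act_walk.
congr walk; elim: w wa {uw} => //= b w IH wa.
by inversion wa; rewrite asboolT // IH.
Qed.

(** A hyperplane is encoded by its dual edges in both orientations, so that equality of hyperplanes
    becomes equality of sets. *)
Definition wall z a : set (V * E) :=
  [set e | (e.2 = a /\ ladder a z e.1) \/
           (e.2 = bar a /\ ladder a z (step e.1 e.2))].

Lemma wall_inv z a z' a' : wall z a = wall z' a' ->
  (a' = a /\ ladder a z z') \/ (a' = bar a /\ ladder a z (step z' a')).
Proof.
move=> zz'; suff: wall z a (z', a') by [].
by rewrite zz'; left; split=> //; exact: ladder_refl.
Qed.

Lemma wall_ladder a z z' : ladder a z z' -> wall z a = wall z' a.
Proof.
move=> zz'; apply/seteqP; split=> -[y b] /= [[e yz]|[e yz]].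
- by left; split=> //; apply: ladder_trans (ladder_sym zz') yz.
- by right; split=> //; apply: ladder_trans (ladder_sym zz') yz.
- by left; split=> //; apply: ladder_trans zz' yz.
- by right; split=> //; apply: ladder_trans zz' yz.
Qed.

Lemma wall_bar z a : wall (step z a) (bar a) = wall z a.
Proof.
apply/seteqP; split=> -[y b] /=.
- rewrite /wall /= barK => -[] [-> /ladder_bar/ladder_sym zy].
    right; split=> //; apply: ladder_sym.
    by rewrite -(stepK z a) -(ladder_bar a); apply/ladder_cross/ladder_bar.
  left; split=> //; apply: ladder_sym.
  rewrite -(stepK z a) -(stepK y a) -(ladder_bar a).
  exact/ladder_cross/ladder_bar.
- rewrite /wall /= barK => -[] [-> zy].
    by right; split=> //; apply/ladder_bar/ladder_cross.
  by left; split=> //; apply/ladder_bar; rewrite -(stepVK y a); apply/ladder_cross.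
Qed.

Lemma wall_comm z a b : adj a b -> wall (step z a) b = wall z b.
Proof. by move=> /adj_sym ba; apply/esym/wall_ladder/ladder_step. Qed.

Lemma wall_adj_neq z z' a b : adj a b -> wall z b <> wall z' a.
Proof.
move=> ab /esym/wall_inv; have [] := adj_neq ab.
by move=> ? ? [[]|[]].
Qed.

(** * Walls crossed by a walk, and separation of vertices *)

Fixpoint walls z w : seq (set (V * E)) :=
  if w is a :: w' then wall z a :: walls (step z a) w' else [::].

Lemma walls_cat z u w : walls z (u ++ w) = walls z u ++ walls (walk z u) w.
Proof. by elim: u z => //= a u IH z; rewrite IH. Qed.

Lemma size_walls z w : size (walls z w) = size w.
Proof. by elim: w z => //= a w IH z; rewrite IH. Qed.

Lemma mem_walls W z w : W \in walls z w ->
  exists w1 a w2, w = w1 ++ a :: w2 /\ W = wall (walk z w1) a.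
Proof.
elim: w z => //= a w IH z; rewrite inE => /orP[/eqP->|/IH].
  by exists [::], a, w.
by move=> [w1 [b [w2 [-> ->]]]]; exists (a :: w1), b, w2.
Qed.

(** The parity of the crossings of [W] depends only on the endpoints: opposite sides of a square lie
    on the same wall by [wall_comm], and backtracking recrosses a wall by [wall_bar]. *)
Lemma colouring (W : set (V * E)) x :
  exists F : V -> bool, [/\ F x = false,
    forall z a, F (step z a) = F z (+) (wall z a == W)
    & forall z w, F (walk z w) = F z (+) odd (count_mem W (walls z w))].
Proof.
(* The vertex is carried along with the colour, since the action has to know which edge is
   crossed. *)
pose act (q : V * bool) a := (step q.1 a, q.2 (+) (wall q.1 a == W)).
have [||F [Fx FS]] := @transport C _ act _ _ x (x, false).
- by move=> [z b] a; rewrite /act /= stepK wall_bar addbK.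
- move=> [z d] a b ab; rewrite /act /= step_comm // wall_comm //.
  by rewrite (wall_comm _ (adj_sym ab)) addbAC.
have F1 z : (F z).1 = z.
  by elim/(@vert_ind x): z => [|z a Fz]; rewrite ?Fx // FS /= Fz.
have F2 z a : (F (step z a)).2 = (F z).2 (+) (wall z a == W).
  by rewrite FS /= F1.
exists (fun z => (F z).2); split=> [|//|z w]; first by rewrite Fx.
elim: w z => /= [|a w IH] z; first by rewrite addbF.
by rewrite IH F2 oddD -addbA; case: (_ == _).
Qed.

Definition separates (W : set (V * E)) x z : Prop :=
  exists2 w, walk x w = z & odd (count_mem W (walls x w)).

Lemma separatesP W x F : F x = false ->
  (forall z w, F (walk z w) = F z (+) odd (count_mem W (walls z w))) ->
  forall z, separates W x z <-> F z.
Proof.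
move=> Fx FW z; split=> [[w <-]|]; first by rewrite FW Fx.
by have [w <-] := vert_connected x z; rewrite FW Fx; exists w.
Qed.

(** * Geodesics *)

Definition geodesic x w : Prop :=
  forall w', walk x w' = walk x w -> size w <= size w'.

Lemma geodesicE x z : exists2 w, walk x w = z & geodesic x w.
Proof.
have ex : exists n, `[< exists w, walk x w = z /\ size w = n >].
  by have [w wz] := vert_connected x z; exists (size w); apply/asboolP; exists w.
case: (ex_minnP ex) => n /asboolP[w [wz wn]] nmin; exists w => // w' w'z.
by rewrite wn; apply: nmin; apply/asboolP; exists w'; rewrite w'z.
Qed.

Lemma geodesic_behead x a w : geodesic x (a :: w) -> geodesic (step x a) w.
Proof. by move=> g w' e; have := g (a :: w') e. Qed.

Lemma geodesic_prefix x u w : geodesic x (u ++ w) -> geodesic x u.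
Proof.
move=> g w' e; have := g (w' ++ w); rewrite !foldl_cat e => /(_ erefl).
by rewrite !size_cat leq_add2r.
Qed.

(** A walk recrossing a wall can be shortened: by [ladder_filter] only the letters commuting with
    [a] need to be kept between the two crossings, so that the leading [a] disappears, and the
    second crossing too if it goes backwards. *)
Lemma geodesic_uniq x w : geodesic x w -> uniq (walls x w).
Proof.
elim: w x => //= a w IH x g; rewrite IH ?andbT; last exact: geodesic_behead.
have naa : `[< adj a a >] = false by apply/asboolF/adj_irr.
apply/negP => /mem_walls[w1 [b [w2 [ew]]]]; subst w.
move=> /wall_inv[] [eb xb]; subst b.
- have := @ladder_filter _ _ _ (a :: w1) xb erefl; rewrite /= naa => e.
  have := g ([seq b <- w1 | `[< adj a b >]] ++ a :: w2).
  rewrite /= !foldl_cat /= e => /(_ erefl).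
  by rewrite !size_cat /= ltnNge leq_add2r size_filter count_size.
- have := @ladder_filter _ _ _ (a :: w1 ++ [:: bar a]) xb.
  rewrite /= naa foldl_cat /= => /(_ erefl) e.
  have := g ([seq b <- w1 ++ [:: bar a] | `[< adj a b >]] ++ w2).
  rewrite /= !foldl_cat /= e => /(_ erefl).
  rewrite filter_cat /= asboolF; last by move=> /adj_bar; rewrite barK; exact: adj_irr.
  rewrite cats0 !size_cat /= addnS ltnNge ltnW // ltnS leq_add2r size_filter.
  exact: count_size.
Qed.

(** A wall met exactly once separates the endpoints, so that every walk between them has to cross
    it. *)
Lemma uniq_geodesic x w : uniq (walls x w) -> geodesic x w.
Proof.
move=> uw w' ww'; rewrite -(size_walls x w) -(size_walls x w').
apply: uniq_leq_size => // W Ww; have [F [Fx _ FW]] := colouring W x.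
have := FW x w'; rewrite ww' FW Fx count_uniq_mem // Ww /= => /esym.
by case: (boolP (W \in walls x w')) => // /count_memPn ->.
Qed.

(** An exchange condition, by induction on [u]. If [w] recrosses the wall of the first letter [a],
    then [u] consists of letters commuting with [a], and [a] can be moved to the end of [u] and
    cancelled there. *)
Lemma geodesic_exchange x u w : geodesic x u -> geodesic (walk x u) w ->
  geodesic x (u ++ w) \/
  exists s u', [/\ size u' < size u, walk x u' = step (walk x u) s
                 & wall (walk x u) s \in walls (walk x u) w].
Proof.
elim: u x => [|a u IH] x gu gw; first by left.
have gu' := geodesic_behead gu.
have [guw|[s [u' [su eu' Ws]]]] := IH _ gu' gw; last first.
  by right; exists s, (a :: u').
have uu : wall x a \notin walls (step x a) u by have /= /andP[] := geodesic_uniq gu.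
have [Ww|nWw] := boolP (wall x a \in walls (step x a) (u ++ w)); last first.
  by left; apply: uniq_geodesic => /=; rewrite nWw geodesic_uniq.
right; move: (Ww); rewrite walls_cat mem_cat (negbTE uu) /=.
set y := walk (step x a) u => Wy.
have [w1 [b [w2 [ew]]]] := mem_walls Wy; subst w; set z := walk y w1.
have naa : `[< adj a a >] = false by apply/asboolF/adj_irr.
have naba : `[< adj a (bar a) >] = false.
  by apply/asboolF => /adj_bar; rewrite barK; exact: adj_irr.
pose f := [seq b <- u ++ w1 | `[< adj a b >]].
have sf : size f <= size (u ++ w1) by rewrite size_filter count_size.
have fadj : List.Forall (adj a) f.
  rewrite /f; elim: (u ++ w1) => //= c v IHv.
  by case: asboolP => // ac; constructor.
have fcomm v t : List.Forall (adj a) v -> walk (step t a) v = step (walk t v) a.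
  elim: v t => //= c v IHv t va; inversion va.
  by rewrite -IHv // step_comm.
move=> /wall_inv[] [eb xz]; subst b.
(* Two crossings in the same direction are impossible: the commuting letters would shortcut the
   geodesic [u ++ w]. *)
- have fz : walk x f = z.
    have := @ladder_filter _ _ _ (a :: u ++ w1) xz.
    by rewrite /= naa foldl_cat => /(_ erefl).
  have g1 : geodesic (step x a) ((u ++ w1) ++ [:: a]).
    by move: guw; rewrite -cat1s !catA => /geodesic_prefix.
  have := g1 f; rewrite fcomm // fz !foldl_cat /= => /(_ erefl).
  by rewrite size_cat /= addn1 ltnNge sf.
(* Here minimality forces the filter to keep every letter, whence all of [u] commutes with [a]. *)
- have fz : walk x f = step z (bar a).
    have := @ladder_filter _ _ _ (a :: (u ++ w1) ++ [:: bar a]) xz.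
    rewrite /= naa filter_cat /= naba cats0 !foldl_cat /= => /(_ erefl).
    exact.
  have g1 : geodesic (step x a) (u ++ w1).
    by move: guw; rewrite catA => /geodesic_prefix.
  have := g1 f; rewrite fcomm // fz stepVK foldl_cat => /(_ erefl).
  rewrite /f size_filter => sle.
  have /all_filterP ef : all (fun b => `[< adj a b >]) (u ++ w1).
    by rewrite all_count eqn_leq count_size.
  have ua : List.Forall (adj a) u.
    by move: fadj; rewrite /f ef => /List.Forall_app[].
  exists (bar a), u; have yE : y = step (walk x u) a by rewrite /y fcomm.
  rewrite /= -/y {1}yE stepK; split=> //.
  suff -> : wall y (bar a) = wall x a by [].
  by rewrite -(wall_bar x a); apply/esym/wall_ladder; exists u => //;
     apply: List.Forall_impl ua => c /adj_barl.
Qed.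

(** * Balls and spheres *)

Definition ball x n : set V := [set z | exists2 w, size w <= n & walk x w = z].

Lemma ball_step x n z a : ball x n z -> ball x n.+1 (step z a).
Proof.
by move=> [w wn <-]; exists (rcons w a); rewrite ?size_rcons // foldl_rcons.
Qed.

Lemma ball_leq x m n : m <= n -> ball x m `<=` ball x n.
Proof. by move=> mn z [w wm <-]; exists w => //; exact: leq_trans mn. Qed.

(** A geodesic from [x] to [y] followed by one from [y] to [z] is too long to be geodesic, because
    [z] lies in the ball; the exchange condition then provides [s]. *)
Lemma sphere_separated x n y z : ball x n.+1 y -> ~ ball x n y ->
  ball x n.+1 z -> z <> y ->
  exists2 s, ball x n (step y s) & separates (wall y s) y z.
Proof.
move=> [u un uy] yn [v vn vz] zy.
have [su gu] : size u = n.+1 /\ geodesic x u.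
  have nu w : walk x w = y -> n < size w.
    by move=> wy; rewrite ltnNge; apply/negP => wn; apply: yn; exists w.
  have sun : size u = n.+1 by apply/eqP; rewrite eqn_leq un nu.
  by split=> // w; rewrite uy => /nu; rewrite sun.
have [w wz gw] := geodesicE y z.
have := geodesic_exchange gu; rewrite uy => /(_ _ gw) [guw|].
  have := guw v; rewrite foldl_cat uy wz vz => /(_ erefl).
  rewrite size_cat su => /leq_trans/(_ vn); rewrite -{2}(addn0 n.+1) leq_add2l.
  by rewrite leqn0 => /nilP w0; case: zy; rewrite -wz w0.
move=> [s [u' [u'u yE Ws]]]; exists s.
  by exists u' => //; move: u'u; rewrite su.
by exists w => //; rewrite count_uniq_mem ?Ws // geodesic_uniq.
Qed.

End Words.

(** * Families of link automorphisms *)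

Section LocalFamilies.
Variable C : labelled_cover.
Local Notation V := (vert C).
Local Notation E := (letter C).
Local Notation adj := (@adj C).
Local Notation bar := (@bar C).
Local Notation step := (@step C).
Local Notation walk := (foldl step).
Local Notation link_aut := (graph_automorphism adj).
Implicit Types (x y z : V) (a b c s : E).

(* The family of the actions of an automorphism of the complex on the links of
   the vertices, all of which are identified with the graph of letters. *)
Definition compatible (phi : V -> E -> E) : Prop :=
  (forall z, link_aut (phi z)) /\
  forall z a, phi (step z a) (bar a) = bar (phi z a) /\
    forall b, adj a b -> phi (step z a) b = phi z b.

(** The image vertex is transported along with the source; compatibility turns the relations at the
    source into relations at the image. Inverting every [phi z] yields the inverse map in the same
    way. *)
Lemma compatible_integral phi x y : compatible phi ->
  exists G H psi, [/\ G x = y, compatible psi,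
    forall z a, G (step z a) = step (G z) (phi z a),
    forall z a, H (step z a) = step (H z) (psi z a)
    & [/\ cancel G H, cancel H G, forall z, cancel (phi z) (psi (G z))
        & forall z, cancel (psi z) (phi (H z))]].
Proof.
move=> [phi_aut phiE].
have /choice[inv invE] : forall z, exists g, cancel (phi z) g /\ cancel g (phi z).
  by move=> z; have [[g gK Kg] _] := phi_aut z; exists g.
have phiK z := (invE z).1; have invK z := (invE z).2.
have phi_adj z a b : adj (phi z a) (phi z b) <-> adj a b.
  by have [_] := phi_aut z; apply.
have inv_adj z a b : adj (inv z a) (inv z b) <-> adj a b.
  by rewrite -(phi_adj z) !invK.
pose act (q : V * V) a := (step q.1 a, step q.2 (phi q.1 a)).
have [||G2 [G2x G2S]] := @transport C _ act _ _ x (x, y).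
- by move=> [z t] a; rewrite /act /= (phiE z a).1 !stepK.
- move=> [z t] a b ab; rewrite /act /=; congr pair; first exact: step_comm.
  rewrite (phiE z a).2 // (phiE z b).2; last exact: adj_sym.
  by apply: step_comm; rewrite phi_adj.
have G2E z : (G2 z).1 = z.
  by elim/(@vert_ind C x): z => [|z a Pz]; rewrite ?G2x ?G2S //= Pz.
pose G z := (G2 z).2.
have GS z a : G (step z a) = step (G z) (phi z a) by rewrite /G G2S /= G2E.
have inv_bar z b : inv (step z (inv z b)) (bar b) = bar (inv z b).
  by apply: (can_inj (phiK (step z (inv z b)))); rewrite invK (phiE _ _).1 invK.
have inv_nbr z b c : adj b c -> inv (step z (inv z b)) c = inv z c.
  move=> bc; apply: (can_inj (phiK (step z (inv z b)))).
  by rewrite invK (phiE _ _).2 ?invK // inv_adj.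
have [||H [Hy HS]] := @transport C _ (fun z b => step z (inv z b)) _ _ y x.
- by move=> z b; rewrite inv_bar stepK.
- move=> z b c bc; rewrite (inv_nbr _ _ _ bc) (inv_nbr _ _ _ (adj_sym bc)).
  by apply: step_comm; rewrite inv_adj.
have Gx : G x = y by rewrite /G G2x.
have GK : cancel G H.
  move=> z; elim/(@vert_ind C x): z => [|z a Pz]; rewrite ?Gx //.
  by rewrite GS HS Pz phiK.
have HK : cancel H G.
  move=> z; elim/(@vert_ind C y): z => [|z a Pz]; rewrite ?Hy //.
  by rewrite HS GS Pz invK.
exists G, H, (fun z => inv (H z)); split=> //.
  split=> [z|z a].
    by split; [exists (phi (H z)) | exact: inv_adj].
  by rewrite HS inv_bar; split=> // b ab; rewrite inv_nbr.
by split=> // z; rewrite /= GK.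
Qed.

(** * Inversions of single letters *)

Definition swap a b : E :=
  if `[< b = a >] then bar a else if `[< b = bar a >] then a else b.

Lemma swapl a : swap a a = bar a.
Proof. by rewrite /swap asboolT. Qed.

Lemma swapr a : swap a (bar a) = a.
Proof. by rewrite /swap; case: asboolP => [//|_]; rewrite asboolT. Qed.

Lemma swap_id a b : b <> a -> b <> bar a -> swap a b = b.
Proof. by move=> ba bba; rewrite /swap !asboolF. Qed.

Lemma swap_adj a b : adj a b -> swap a b = b.
Proof. by case/adj_neq; exact: swap_id. Qed.

Variant swap_spec a b : E -> Prop :=
| SwapL of b = a : swap_spec a b (bar a)
| SwapR of b = bar a : swap_spec a b a
| SwapN of b <> a & b <> bar a : swap_spec a b b.

Lemma swapP a b : swap_spec a b (swap a b).
Proof.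
have [->|ba] := pselect (b = a); first by rewrite swapl; constructor.
have [->|bba] := pselect (b = bar a); first by rewrite swapr; constructor.
by rewrite swap_id //; constructor.
Qed.

Lemma swapK a : involutive (swap a).
Proof.
by move=> b; case: (swapP a b) => *; subst; rewrite ?swapl ?swapr ?swap_id.
Qed.

Lemma swap_bar a : swap (bar a) = swap a.
Proof.
apply/funext => b; case: (swapP a b) => [->|->|ba bba].
- by rewrite -{2}(barK a) swapr.
- by rewrite swapl barK.
- by rewrite swap_id // barK.
Qed.

Lemma adj_bar_iff a b : adj a (bar b) <-> adj a b.
Proof. by split=> /adj_bar //; rewrite barK. Qed.

Lemma swap_mono a b c : adj (swap a b) (swap a c) <-> adj b c.
Proof.
have sw d e : adj d (swap a e) <-> adj d e.
  case: (swapP a e) => [->|->|//]; first exact: adj_bar_iff.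
  by apply: iff_sym; exact: adj_bar_iff.
by rewrite sw; split=> /adj_sym; [rewrite sw|rewrite -(sw c b)] => /adj_sym.
Qed.

Lemma swap_aut a : link_aut (swap a).
Proof. by split; [exists (swap a); exact: swapK | exact: swap_mono]. Qed.

Lemma swap_comm a b c : adj a b -> swap a (swap b c) = swap b (swap a c).
Proof.
move=> ab; have ba := adj_sym ab.
case: (swapP a c) => [->|->|ca cba].
- by rewrite (swap_adj ba) swapl swap_adj //; exact: adj_bar.
- by rewrite (swap_adj (adj_bar ba)) swapr swap_adj.
- case: (swapP b c) => [cb|cb|*]; last by rewrite swap_id.
    by rewrite swap_adj //; exact: adj_bar.
  by rewrite swap_adj.
Qed.

Lemma link_aut_comp (f g : E -> E) : link_aut f -> link_aut g -> link_aut (f \o g).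
Proof.
move=> [fb fa] [gb ga]; split; first exact: bij_comp.
by move=> a b; rewrite /= fa ga.
Qed.

(** The two inversions make [bar a] go to [bar (phi a)], as compatibility along the edge [a]
    demands, and leave the values on letters commuting with [a] unchanged. *)
Definition swap_conj (phi : E -> E) a : E -> E := swap (phi a) \o phi \o swap a.

Lemma swap_conj_aut phi a : link_aut phi -> link_aut (swap_conj phi a).
Proof.
move=> phi_aut; apply: link_aut_comp; last exact: swap_aut.
by apply: link_aut_comp => //; exact: swap_aut.
Qed.

Lemma swap_conj_bar phi a : swap_conj phi a (bar a) = bar (phi a).
Proof. by rewrite /swap_conj /= swapr swapl. Qed.

Lemma swap_conj_adj phi a b : link_aut phi -> adj a b -> swap_conj phi a b = phi b.
Proof.
move=> [_ phi_adj] ab; rewrite /swap_conj /= (swap_adj ab) swap_adj //.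
by rewrite phi_adj.
Qed.

(* The links of [a] and [bar a] in the graph of letters coincide, so that an
   automorphism of the link of one vertex can be transported along edges by
   conjugating it with swaps. *)
Lemma link_aut_transport phi y : link_aut phi ->
  exists Phi, [/\ compatible Phi, Phi y = phi
    & forall z a, Phi (step z a) = swap_conj (Phi z) a].
Proof.
move=> phi_aut.
(* The action is trivial outside the automorphisms, because [transport] asks for the relations at
   every state. *)
pose act phi a := if `[< link_aut phi >] then swap_conj phi a else phi.
have [||Phi [Phiy PhiS]] := @transport C _ act _ _ y phi.
- move=> f a; rewrite /act; case: (asboolP (link_aut f)) => [fa|nf];
    last by rewrite asboolF.
  rewrite asboolT; last exact: swap_conj_aut.
  apply/funext => b; rewrite {1}/swap_conj /= swap_conj_bar !swap_bar.
  by rewrite /swap_conj /= !swapK.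
- move=> f a b ab; rewrite /act; case: (asboolP (link_aut f)) => [fa|nf];
    last by rewrite asboolF.
  rewrite !asboolT; [|exact: swap_conj_aut..].
  have conjE g d e : swap_conj g d e = swap (g d) (g (swap d e)) by [].
  apply/funext => c; rewrite (conjE (swap_conj f a)) (conjE (swap_conj f b)).
  rewrite (swap_conj_adj fa ab) (swap_conj_adj fa (adj_sym ab)) !conjE.
  rewrite (swap_comm _ (adj_sym ab)) [LHS]swap_comm //.
  by rewrite fa.2; exact: adj_sym.
have Paut z : link_aut (Phi z).
  elim/(@vert_ind C y): z => [|z a Pz]; rewrite ?Phiy // PhiS /act asboolT //.
  exact: swap_conj_aut.
have PS z a : Phi (step z a) = swap_conj (Phi z) a.
  by rewrite PhiS /act asboolT.
exists Phi; split=> //; split=> // z a; rewrite PS swap_conj_bar; split=> // b ab.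
exact: swap_conj_adj.
Qed.

Definition fixes_star (phi : E -> E) s : Prop :=
  phi s = s /\ forall b, adj s b -> phi b = b.

(* Let the transported automorphism act on the intersection of the halfspaces
   containing [y] that are bounded by the hyperplanes dual to the edges at [y]
   with labels in [D], and extend it by the identity. *)
Lemma halfspace_family (D : set E) phi y : link_aut phi ->
  (forall s, D s -> fixes_star phi s) ->
  exists psi, [/\ compatible psi, psi y = phi,
    forall z s, D s -> separates (wall y s) y z -> psi z = id
    & forall G, G y = y -> (forall z a, G (step z a) = step (G z) (psi z a)) ->
      forall z s, D s -> separates (wall y s) y z -> G z = z].
Proof.
move=> phi_aut phiD.
have [Phi [[Paut PhiE] Phiy PhiS]] := link_aut_transport y phi_aut.
pose out z := exists2 s, D s & separates (wall y s) y z.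
pose psi z := if `[< out z >] then id else Phi z.
have sep_cross s z a : separates (wall y s) y (step z a) ->
    ~ separates (wall y s) y z -> wall z a = wall y s.
  have [F [Fy FS FW]] := colouring (wall y s) y.
  rewrite !(separatesP Fy FW) FS => Fza /negP/negbTE Fz.
  by move: Fza; rewrite Fz /= => /eqP.
(* Along the near side of the hyperplane of [s], the star of [s] stays fixed: the letters [b] of a
   ladder are fixed, so that transport along [b] only conjugates by [swap b]. *)
have ladder_star s z : D s -> ladder s y z ->
    fixes_star (Phi z) s /\ ~ separates (wall y s) y z.
  move=> Ds; have [F [Fy FS FW]] := colouring (wall y s) y.
  rewrite (separatesP Fy FW); move: z.
  apply: (ladder_ind (P := fun z => fixes_star (Phi z) s /\ ~ F z)).
    by rewrite Phiy Fy; split=> //; exact: phiD.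
  move=> z b sb [[Ps Pn] Fz]; split; last first.
    by rewrite FS; case: eqP => [/(wall_adj_neq sb)|_]; rewrite ?addbF.
  rewrite PhiS; split=> [|c sc]; rewrite /swap_conj /= (Pn _ sb).
    by rewrite (swap_adj (adj_sym sb)) Ps (swap_adj (adj_sym sb)).
  have -> : Phi z (swap b c) = swap b c; last exact: swapK.
  apply: Pn; case: (swapP b c) => // _; exact: adj_bar.
(* An edge leaving the near region crosses one of the hyperplanes in the direction of its letter in
   [D]. The star of that letter is fixed at its start, which is what gluing with the identity
   needs. *)
have boundary z a : ~ out z -> out (step z a) ->
    ladder a y z /\ fixes_star (Phi z) a /\ D a.
  move=> oz [s Ds sza].
  have nsz : ~ separates (wall y s) y z by move=> sz; apply: oz; exists s.
  have /esym/wall_inv[[ea yz]|[_ yz]] := sep_cross _ _ _ sza nsz.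
    by rewrite ea; split=> //; split=> //; exact: (ladder_star s z Ds yz).1.
  by case: (ladder_star _ _ Ds yz).2.
have psi_out z : out z -> psi z = id by move=> oz; rewrite /psi asboolT.
have psi_in z : ~ out z -> psi z = Phi z by move=> oz; rewrite /psi asboolF.
have outy : ~ out y.
  move=> [s _]; have [F [Fy FS FW]] := colouring (wall y s) y.
  by rewrite (separatesP Fy FW) Fy.
exists psi; split.
- split=> [z|z a].
    rewrite /psi; case: ifP => _ //.
    by split; first by exists id.
  have [oz|oz] := pselect (out z); have [oza|oza] := pselect (out (step z a)).
  + by rewrite !psi_out.
  + have := @boundary (step z a) (bar a) oza; rewrite stepK => /(_ oz)[_ [[Pa Pn] _]].
    by rewrite (psi_out _ oz) (psi_in _ oza) Pa; split=> // b /adj_barl/Pn.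
  + have [_ [[Pa Pn] _]] := boundary _ _ oz oza.
    by rewrite (psi_out _ oza) (psi_in _ oz) Pa; split=> // b /Pn.
  + by rewrite !psi_in.
- by rewrite psi_in.
- by move=> z s Ds sz; apply: psi_out; exists s.
(* Outside, every step keeps its letter; an exit starts on a ladder from [y], along which [G] is the
   identity by induction. *)
- move=> G Gy GS z s Ds sz; have oz : out z by exists s.
  move: oz {s Ds sz}; elim/(@vert_ind C y): z => [//|z a IH oza].
  rewrite GS; have [oz|oz] := pselect (out z); first by rewrite IH // psi_out.
  have [yz [[Pa Pn] Da]] := boundary _ _ oz oza.
  rewrite psi_in // Pa; congr step.
  suff [] : ladder a y z /\ G z = z by [].
  apply: (ladder_ind (P := fun t => ladder a y t /\ G t = t)) yz.
    by split=> //; exact: ladder_refl.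
  move=> t b ab [yt Gt]; split; first exact/(ladder_trans yt)/ladder_step.
  rewrite GS Gt; have [ot|/psi_in ->] := pselect (out t); first by rewrite psi_out.
  by rewrite (ladder_star _ _ Da yt).1.2.
Qed.

End LocalFamilies.

(** * Faces of cubes *)

Section Faces.
Variable n : nat.
Implicit Types (w : 'I_n -> bool) (k l : 'I_n).

Definition flip_at w k : 'I_n -> bool := fun l => (l == k) (+) w l.

Lemma out_edge_subproof w k :
  face_map_spec [ffun l => (if l == k then Some (ord0 : 'I_1) else None, w l)].
Proof.
by apply: face_map_specI => i; exists k => l; rewrite ffunE (ord1 i); case: (l == k).
Qed.

(* The edge in direction [k] oriented so that it starts at the vertex [w]. *)
Definition out_edge w k : face_map 1 n := FaceMap (out_edge_subproof w k).

Lemma out_square_subproof w k l : k != l ->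
  face_map_spec [ffun j => (if j == k then Some (ord0 : 'I_2)
                            else if j == l then Some ord_max else None, w j)].
Proof.
move=> kl; apply: face_map_specI => i.
have [->|i1] := eqVneq i ord0.
  by exists k => j; rewrite ffunE /=; case: (j == k) => //; case: (j == l).
exists l => j; rewrite ffunE /=; have [->|jk] := eqVneq j k.
  by rewrite (negbTE kl) eq_sym; apply/negbTE.
case: (j == l) => //; apply/eqP; congr Some; apply/val_inj.
by case: i i1 => -[|[|]].
Qed.

Definition out_square w k l (kl : k != l) : face_map 2 n :=
  FaceMap (out_square_subproof w kl).

Lemma out_edge_source w k :
  face_comp (out_edge w k) (corner_map (fun=> false)) = corner_map w.
Proof.
apply/val_inj/ffunP => j; rewrite !ffunE /comp_coord /=.
by case: (j == k); rewrite /= ?ffunE.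
Qed.

Lemma out_edge_target w k :
  face_comp (out_edge w k) (corner_map (fun=> true)) = corner_map (flip_at w k).
Proof.
apply/val_inj/ffunP => j; rewrite !ffunE /comp_coord /= /flip_at.
by case: (j == k); rewrite /= ?ffunE.
Qed.

Lemma out_edge_flip w k : face_comp (out_edge w k) flip_map = out_edge (flip_at w k) k.
Proof.
apply/val_inj/ffunP => j; rewrite !ffunE /comp_coord /= /flip_at.
by case: (j == k); rewrite /= ?ffunE.
Qed.

Lemma out_square_bottom w k l (kl : k != l) :
  face_comp (out_square w kl) (edge_map ord0 (fun=> false)) = out_edge w k.
Proof.
apply/val_inj/ffunP => j; rewrite !ffunE /comp_coord /=.
have [_|jk] := eqVneq j k; first by rewrite /= ffunE.
by case: (j == l); rewrite /= ?ffunE.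
Qed.

Lemma out_square_left w k l (kl : k != l) :
  face_comp (out_square w kl) (edge_map ord_max (fun=> false)) = out_edge w l.
Proof.
apply/val_inj/ffunP => j; rewrite !ffunE /comp_coord /=.
have [->|jk] := eqVneq j k; first by rewrite /= ffunE (negbTE kl).
by case: (j == l); rewrite /= ?ffunE.
Qed.

Lemma out_square_top w k l (kl : k != l) :
  face_comp (out_square w kl) (edge_map ord0 (fun=> true)) =
  out_edge (flip_at w l) k.
Proof.
apply/val_inj/ffunP => j; rewrite !ffunE /comp_coord /= /flip_at.
have [->|jk] := eqVneq j k; first by rewrite /= ffunE (negbTE kl).
by case: (j == l); rewrite /= ?ffunE.
Qed.

Lemma out_square_right w k l (kl : k != l) :
  face_comp (out_square w kl) (edge_map ord_max (fun=> true)) =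
  out_edge (flip_at w k) l.
Proof.
apply/val_inj/ffunP => j; rewrite !ffunE /comp_coord /= /flip_at.
have [->|jk] := eqVneq j k; first by rewrite /= ffunE (negbTE kl).
by case: (j == l); rewrite /= ?ffunE.
Qed.

Lemma out_edge_axis k : edge_map k (fun=> false) = out_edge (fun=> false) k.
Proof. by apply/val_inj/ffunP => j; rewrite !ffunE; case: (j == k). Qed.

Lemma reflect_subproof w : face_map_spec [ffun k => (Some k, w k)].
Proof. by apply: face_map_specI => i; exists i => k; rewrite ffunE. Qed.

Definition reflect_map w : face_map n n := FaceMap (reflect_subproof w).

Lemma reflect_mapK w : face_comp (reflect_map w) (reflect_map w) = face_id n.
Proof.
by apply/val_inj/ffunP => j; rewrite !ffunE /comp_coord /= ffunE addbb.
Qed.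

Lemma reflect_map_corner w :
  face_comp (reflect_map w) (corner_map (fun=> false)) = corner_map w.
Proof. by apply/val_inj/ffunP => j; rewrite !ffunE /comp_coord /= ffunE. Qed.

End Faces.

Section CubeComplex.
Variable K : cube_complex.
Implicit Types (e : cell K 1) (s : cell K 2).

Lemma base_vertex (v : cell K 0) : base v = v.
Proof.
rewrite /base /corner -[RHS]face_idE; congr face.
by apply/val_inj/ffunP => -[].
Qed.

Lemma axis_edge e : axis e ord0 = e.
Proof.
rewrite /axis -[RHS]face_idE; congr face.
by apply/val_inj/ffunP => i; rewrite !ffunE !ord1.
Qed.

Lemma reverseK : involutive (@reverse K).
Proof.
move=> e; rewrite /reverse -face_compE -[RHS]face_idE; congr face.
by apply/val_inj/ffunP => i; rewrite !ffunE /comp_coord /= !ffunE !ord1.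
Qed.

Lemma source_reverse e : source (reverse e) = target e.
Proof.
rewrite /source /target /corner /reverse -face_compE; congr face.
by apply/val_inj/ffunP => i; rewrite !ffunE /comp_coord /= !ffunE.
Qed.

Lemma target_reverse e : target (reverse e) = source e.
Proof. by rewrite -source_reverse reverseK. Qed.

Section Cell.
Variables (n : nat) (c : cell K n).
Implicit Types (w : 'I_n -> bool) (k l : 'I_n).

Lemma source_out_edge w k : source (face (out_edge w k) c) = corner c w.
Proof. by rewrite /source /corner -face_compE out_edge_source. Qed.

Lemma target_out_edge w k : target (face (out_edge w k) c) = corner c (flip_at w k).
Proof. by rewrite /target /corner -face_compE out_edge_target. Qed.

Lemma reverse_out_edge w k :
  reverse (face (out_edge w k) c) = face (out_edge (flip_at w k) k) c.
Proof. by rewrite /reverse -face_compE out_edge_flip. Qed.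

Lemma axisE k : axis c k = face (out_edge (fun=> false) k) c.
Proof. by rewrite /axis out_edge_axis. Qed.

Lemma bottom_out_square w k l (kl : k != l) :
  bottom_edge (face (out_square w kl) c) = face (out_edge w k) c.
Proof. by rewrite /bottom_edge -face_compE out_square_bottom. Qed.

Lemma left_out_square w k l (kl : k != l) :
  left_edge (face (out_square w kl) c) = face (out_edge w l) c.
Proof. by rewrite /left_edge -face_compE out_square_left. Qed.

Lemma top_out_square w k l (kl : k != l) :
  top_edge (face (out_square w kl) c) = face (out_edge (flip_at w l) k) c.
Proof. by rewrite /top_edge -face_compE out_square_top. Qed.

Lemma right_out_square w k l (kl : k != l) :
  right_edge (face (out_square w kl) c) = face (out_edge (flip_at w k) l) c.
Proof. by rewrite /right_edge -face_compE out_square_right. Qed.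

Lemma span_square_out_edge w k l : k != l ->
  span_square (face (out_edge w k) c) (face (out_edge w l) c).
Proof.
by move=> kl; exists (face (out_square w kl) c);
   rewrite bottom_out_square left_out_square.
Qed.

Lemma axis_face m (f : face_map m n) (i : 'I_m) k : (f k).1 = Some i ->
  axis (face f c) i = face (out_edge (fun l => (f l).2) k) c.
Proof.
move=> fk; rewrite /axis -face_compE; congr face.
apply/val_inj/ffunP => l; rewrite !ffunE /comp_coord.
have [->|lk] := eqVneq l k; first by rewrite fk ffunE eqxx /=.
case fl: (f l).1 => [j|]; last by [].
have ji : j != i.
  apply: contra lk => /eqP ji.
  have /eqP/mem_card1[k' fk'] := forallP (face_coordP f) i.
  have := fk' l; have := fk' k; rewrite !inE fk fl ji eqxx => /esym/eqP-> /esym/eqP->.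
  by [].
by rewrite ffunE (negbTE ji).
Qed.

Lemma base_face m (f : face_map m n) : base (face f c) = corner c (fun l => (f l).2).
Proof.
rewrite /base /corner -face_compE; congr face.
apply/val_inj/ffunP => l; rewrite !ffunE /comp_coord.
by case: (f l) => -[j|] b //=; rewrite ffunE.
Qed.

Lemma cube_vertex_ind (P : ('I_n -> bool) -> Prop) : P (fun=> false) ->
  (forall w k, P w -> P (flip_at w k)) -> forall w, P w.
Proof.
move=> P0 PS w; have [m] := ubnP #|[pred k | w k]|.
elim: m w => // m IH w wm; have [k wk|w0] := pickP [pred k | w k]; last first.
  by suff -> : w = fun=> false by []; apply/funext => k; exact: w0.
have -> : w = flip_at (flip_at w k) k.
  by apply/funext => l; rewrite /flip_at addbA addbb.
apply/PS/IH; rewrite -ltnS; apply: leq_trans wm; rewrite ltnS.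
apply/proper_card/properP; split; last first.
  by exists k; rewrite // inE /flip_at eqxx; move: wk => /= ->.
apply/fintype.subsetP => l; rewrite !inE /flip_at; have [->|//] := eqVneq l k.
by move: wk => /= ->.
Qed.

End Cell.

Lemma span_square_swap e e' : span_square e e' -> span_square e' e.
Proof.
move=> [s [<- <-]].
have -> : bottom_edge s = face (out_edge (fun=> false) ord0) s by rewrite -axisE.
have -> : left_edge s = face (out_edge (fun=> false) ord_max) s by rewrite -axisE.
exact: span_square_out_edge.
Qed.

Lemma source_bottom s : source (bottom_edge s) = base s.
Proof. by rewrite -[bottom_edge s]/(axis s ord0) axisE source_out_edge. Qed.

Lemma source_left s : source (left_edge s) = base s.
Proof. by rewrite -[left_edge s]/(axis s ord_max) axisE source_out_edge. Qed.

Lemma square_edges s : let O := ord0 : 'I_2 in let I := ord_max : 'I_2 in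
  let w := fun=> false in
  [/\ bottom_edge s = face (out_edge w O) s, left_edge s = face (out_edge w I) s,
      top_edge s = face (out_edge (flip_at w I) O) s
    & right_edge s = face (out_edge (flip_at w O) I) s].
Proof.
have kl : (ord0 : 'I_2) != ord_max by [].
(* The square is its own two-dimensional face at the origin, so that the formulas for [out_square]
   apply to it. *)
have s_id : s = face (out_square (fun=> false) kl) s.
  rewrite -[LHS]face_idE; congr face; apply/val_inj/ffunP => j; rewrite !ffunE.
  by case: j => -[|[|//]] jP; congr (Some _, _); apply/val_inj.
by rewrite {1 3 5 7}s_id bottom_out_square left_out_square top_out_square
  right_out_square.
Qed.

End CubeComplex.

(** * Special complexes with one vertex *)

(* One vertex, and opposite edges of squares coincide: such a complex is the
   Salvetti complex of a right-angled Artin group. *)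
Record salvetti (S : cube_complex) : Prop := Salvetti {
  salvetti_vertex : forall v v' : cell S 0, v = v';
  salvetti_top : forall s : cell S 2, top_edge s = bottom_edge s;
  salvetti_right : forall s : cell S 2, right_edge s = left_edge s;
  salvetti_embedded : forall a : cell S 1, ~ span_square a a;
  salvetti_npc : nonpositively_curved S
}.

(** Edges of [S] lift to [X], whose vertices all have the same image; hence [S] has one vertex. Two
    distinct parallel edges would then share their source, and either span a square, against
    embeddedness, or directly self-osculate. So opposite edges of squares coincide. *)
Lemma special_salvetti S X (p : cube_map X S) :
  connected_complex S -> nonpositively_curved S -> special S -> covering p ->
  vertex_transitive (deck_group p) -> (exists x : cell X 0, True) -> salvetti S.
Proof.
move=> Sconn Snpc [Shyp _] pcov pdeck [x _].
have pX y : p _ y = p _ x by have [g gp <-] := pdeck x y; exact: gp.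
have vertexE v : v = p _ x.
  have [q] := Sconn.2 (p _ x) v.
  suff: forall q (u v : cell S 0), u = p _ x -> edge_path u q v -> v = p _ x.
    by apply.
  elim=> [u v' -> <- //|e {}q IH u v' -> [eu]]; apply: IH.
  have [e' [[_ <-] _]] := pcov x 1%N e eu.
  by rewrite /target /corner -cmap_face pX.
have one_vertex (v v' : cell S 0) : v = v' by rewrite (vertexE v) (vertexE v').
have hypP (a : cell S 1) : hyperplane a a by left; apply: rst_refl.
have nspan (a : cell S 1) : ~ span_square a a.
  move=> aa; have [] := Shyp (hyperplane a); first by exists a.
  by case; exists a, a.
have par_eq (a b : cell S 1) : oparallel a b -> a = b.
  move=> ab; have hb : hyperplane a b by left.
  have [emb _ nosc] := Shyp (hyperplane a) (ex_intro _ a erefl).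
  have [//|nab] := pselect (a = b); case: nosc; exists a, b; split=> //.
  by split=> // sab; apply: emb; exists a, b.
have topE (s : cell S 2) : top_edge s = bottom_edge s.
  by apply/esym/par_eq/rst_step; exists s.
(* The right edge is the top edge of the square with its axes exchanged. *)
split=> // s; have lk : (ord_max : 'I_2) != ord0 by [].
have := topE (face (out_square (fun=> false) lk) s).
rewrite top_out_square bottom_out_square.
by have [_ -> _ ->] := square_edges s.
Qed.

Section SalvettiCover.
Variables (S X : cube_complex) (p : cube_map X S).
Hypothesis S_salvetti : salvetti S.
Hypothesis p_universal : universal_covering p.
Local Notation V := (cell X 0).
Local Notation E := (cell S 1).
Implicit Types (x y z : V) (a b : E).

Let S_vertex := salvetti_vertex S_salvetti.

(** In the reflected square, the reversed left edge meets the top edge, which equals the bottom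
    one. *)
Lemma adj_reverse a b : span_square a b -> span_square a (reverse b).
Proof.
move=> [s [<- <-]]; have kl : (ord0 : 'I_2) != ord_max by [].
exists (face (out_square (flip_at (fun=> false) ord_max) kl) s).
rewrite bottom_out_square left_out_square.
have [_ -> te _] := square_edges s.
by rewrite reverse_out_edge -te salvetti_top.
Qed.

Lemma parallel_out_edge n (c : cell S n) (w : 'I_n -> bool) k l : l != k ->
  face (out_edge (flip_at w k) l) c = face (out_edge w l) c.
Proof.
rewrite eq_sym => kl.
by rewrite -(right_out_square _ _ kl) (salvetti_right S_salvetti) left_out_square.
Qed.

Lemma lift_subproof x n (c : cell S n) :
  exists! c' : cell X n, base c' = x /\ p _ c' = c.
Proof. by apply: p_universal.2; exact: S_vertex. Qed.

Definition lift x n (c : cell S n) : cell X n :=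
  projT1 (cid (lift_subproof x c)).

Lemma base_lift x n (c : cell S n) : base (lift x c) = x.
Proof. by rewrite /lift; case: cid => c' /= [[]]. Qed.

Lemma map_lift x n (c : cell S n) : p _ (lift x c) = c.
Proof. by rewrite /lift; case: cid => c' /= [[]]. Qed.

Lemma lift_eq n (c c' : cell X n) : base c = base c' -> p _ c = p _ c' -> c = c'.
Proof.
move=> bc pc; have [d [_ d_uniq]] := lift_subproof (base c) (p _ c).
by rewrite -(d_uniq c) // -(d_uniq c').
Qed.

Lemma liftE n (c : cell X n) : lift (base c) (p _ c) = c.
Proof. by apply: lift_eq; rewrite ?base_lift ?map_lift. Qed.

Lemma source_lift x a : source (lift x a) = x. Proof. exact: base_lift. Qed.

Lemma edge_eq (e e' : cell X 1) : source e = source e' -> p _ e = p _ e' -> e = e'.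
Proof. exact: lift_eq. Qed.

Lemma edgeE (e : cell X 1) : lift (source e) (p _ e) = e. Proof. exact: liftE. Qed.

Lemma map_axis n (c : cell X n) i : p _ (axis c i) = axis (p _ c) i.
Proof. by rewrite /axis cmap_face. Qed.

Lemma cell_eq n (c c' : cell X n) : base c = base c' ->
  (forall i, p _ (axis c i) = p _ (axis c' i)) -> c = c'.
Proof.
move=> bc ac; apply: lift_eq => //; apply: (salvetti_npc S_salvetti).1.2.
  exact: S_vertex.
by move=> i; rewrite -!map_axis.
Qed.

Definition move x a : V := target (lift x a).

Lemma move_source e : move (source e) (p _ e) = target e.
Proof. by rewrite /move edgeE. Qed.

Lemma lift_reverse x a : lift (move x a) (reverse a) = reverse (lift x a).
Proof.
apply: edge_eq; first by rewrite source_lift source_reverse.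
by rewrite map_lift /reverse cmap_face map_lift.
Qed.

Lemma moveK x a : move (move x a) (reverse a) = x.
Proof. by rewrite {1}/move lift_reverse target_reverse source_lift. Qed.

Lemma lift_square x a b : span_square a b -> exists s : cell X 2,
  [/\ bottom_edge s = lift x a, left_edge s = lift x b,
      top_edge s = lift (move x b) a & right_edge s = lift (move x a) b].
Proof.
move=> [s [sa sb]]; pose s' := lift x s.
have [be le te re] := square_edges s'.
have bE : bottom_edge s' = lift x a.
  apply: edge_eq; first by rewrite source_bottom base_lift source_lift.
  by rewrite map_lift /bottom_edge cmap_face map_lift.
have lE : left_edge s' = lift x b.
  apply: edge_eq; first by rewrite source_left base_lift source_lift.
  by rewrite map_lift /left_edge cmap_face map_lift.
exists s'; split=> //; apply: edge_eq.
- by rewrite source_lift /move -lE le te source_out_edge target_out_edge.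
- rewrite map_lift /top_edge cmap_face map_lift -sa.
  exact: (salvetti_top S_salvetti).
- by rewrite source_lift /move -bE be re source_out_edge target_out_edge.
- rewrite map_lift /right_edge cmap_face map_lift -sb.
  exact: (salvetti_right S_salvetti).
Qed.

Lemma move_comm x a b : span_square a b -> move (move x a) b = move (move x b) a.
Proof.
move=> ab; have [s [_ _ tE rE]] := lift_square x ab.
rewrite {1}/move -rE [in RHS]/move -tE; have [_ _ -> ->] := square_edges s.
by rewrite !target_out_edge; congr corner; apply/funext => i; rewrite /flip_at addbCA.
Qed.

Lemma walk_path x q y : edge_path x q y -> foldl move x (map (p _) q) = y.
Proof. by elim: q x => //= e q IH x [<- /IH]; rewrite move_source. Qed.

Lemma walk_connected x y : exists w, foldl move x w = y.
Proof.
have [q /walk_path <-] := p_universal.1.1.2 x y.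
by exists (map (p _) q).
Qed.

Lemma edge_path_cat x q y r z : edge_path x q y -> edge_path y r z ->
  edge_path x (q ++ r) z.
Proof. by elim: q x => [x -> //|e q IH x [ex /IH qr] /qr]. Qed.

Lemma edge_path_rev x q y : edge_path x q y ->
  edge_path y (rev (map (@reverse X) q)) x.
Proof.
elim: q x => [x -> //|e q IH x [ex /IH qr]] /=.
rewrite rev_cons -cats1; apply: edge_path_cat qr _.
by rewrite /= source_reverse target_reverse.
Qed.

Section Transport.
Variables (T : Type) (act : T -> E -> T).
Hypothesis actK : forall s a, act (act s a) (reverse a) = s.
Hypothesis act_comm : forall s a b, span_square a b ->
  act (act s a) b = act (act s b) a.

Let fold s (q : seq (cell X 1)) := foldl act s (map (p _) q).

Let fold_cat s q r : fold s (q ++ r) = fold (fold s q) r.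
Proof. by rewrite /fold map_cat foldl_cat. Qed.

Let fold_rev s q : fold (fold s q) (rev (map (@reverse X) q)) = s.
Proof.
elim: q s => //= e q IH s; rewrite rev_cons -cats1 fold_cat IH.
by rewrite /fold /= /reverse cmap_face actK.
Qed.

Let fold_homotopic x y q r : homotopic x y q r -> forall s, fold s q = fold s r.
Proof.
elim=> {q r} [q r [_ _ [q' r' e|q' r' sq]]|//|q r _ IH s|q r t _ IH1 _ IH2 s].
- by move=> s; rewrite !fold_cat /fold /= /reverse cmap_face actK.
- move=> s; rewrite !fold_cat; congr fold; rewrite /fold /=.
  rewrite /bottom_edge /right_edge /left_edge /top_edge !cmap_face.
  have := salvetti_right S_salvetti (p _ sq); rewrite /right_edge => ->.
  have := salvetti_top S_salvetti (p _ sq); rewrite /top_edge => ->.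
  by apply: act_comm; exists (p _ sq).
- by rewrite IH.
- by rewrite IH1 IH2.
Qed.

Let fold_eq x y q r s : edge_path x q y -> edge_path x r y -> fold s q = fold s r.
Proof.
move=> xq xr; have := edge_path_cat xr (edge_path_rev xq).
move=> /(p_universal.1.2 _ _)/fold_homotopic/(_ s); rewrite fold_cat => rq.
have := fold_rev (fold s r) (rev (map (@reverse X) q)).
by rewrite rq map_rev revK -map_comp (eq_map (@reverseK X)) map_id.
Qed.

(** [F z] is computed along any path from [x] to [z]: the action respects elementary homotopies and
    [X] is simply connected. *)
Lemma edge_transport x s : exists F : V -> T,
  F x = s /\ forall z a, F (move z a) = act (F z) a.
Proof.
have /choice[q qP] z := p_universal.1.1.2 x z.
exists (fun z => fold s (q z)); split; first by rewrite (@fold_eq x x _ [::]).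
move=> z a; rewrite (@fold_eq x (move z a) _ (q z ++ [:: lift z a])) //.
  by rewrite fold_cat {1}/fold /= map_lift.
by apply: edge_path_cat (qP z) _; rewrite /= source_lift.
Qed.

End Transport.

Definition salvetti_cover : labelled_cover :=
  @LabelledCover V E (@reverse S) (@span_square S) move (@reverseK S)
    (@span_square_swap S) adj_reverse (salvetti_embedded S_salvetti) moveK
    move_comm edge_transport walk_connected.

End SalvettiCover.

(** * Automorphisms and their actions on links *)

Section SalvettiAut.
Variables (S X : cube_complex) (p : cube_map X S).
Hypothesis S_salvetti : salvetti S.
Hypothesis p_universal : universal_covering p.
Local Notation V := (cell X 0).
Local Notation E := (cell S 1).
Local Notation cover := (salvetti_cover S_salvetti p_universal).
Local Notation lift := (lift S_salvetti p_universal).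
Local Notation move := (move S_salvetti p_universal).
Local Notation adj := (@span_square S).
Local Notation link_aut := (graph_automorphism adj).
Implicit Types (x y z : V) (a b : E) (g h : cube_aut X).
Implicit Types (phi : V -> E -> E) (G : V -> V).

Let compat : (V -> E -> E) -> Prop := @compatible cover.

Lemma compatibleE phi : compat phi -> [/\ forall z, link_aut (phi z),
  forall z a, phi (move z a) (reverse a) = reverse (phi z a)
  & forall z a b, adj a b -> phi (move z a) b = phi z b].
Proof.
by move=> [pa pS]; split=> // z a; [exact: (pS z a).1 | exact: (pS z a).2].
Qed.

Lemma corner_flip n (c : cell X n) w k : corner c (flip_at w k) =
  move (corner c w) (p _ (face (out_edge w k) c)).
Proof. by rewrite -(source_out_edge c w k) move_source target_out_edge. Qed.

Section Family.
Variables (phi : V -> E -> E) (G : V -> V).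
Hypothesis phi_compat : compat phi.
Hypothesis G_move : forall z a, G (move z a) = move (G z) (phi z a).

Definition family_image n (c c' : cell X n) : Prop :=
  base c' = G (base c) /\
  forall i, p _ (axis c' i) = phi (base c) (p _ (axis c i)).

(** The prescription at the base spreads to all corners, one flip at a time; this makes the images
    compatible with faces. *)
Lemma family_image_corner n (c c' : cell X n) : family_image c c' ->
  forall w, corner c' w = G (corner c w) /\
    forall k, p _ (face (out_edge w k) c') =
              phi (corner c w) (p _ (face (out_edge w k) c)).
Proof.
move=> [bc ac]; have [_ phi_rev phi_adj] := compatibleE phi_compat.
apply: cube_vertex_ind; first by split=> // k; rewrite -!axisE ac.
move=> w k [cw ew]; split=> [|l]; first by rewrite !corner_flip cw ew G_move.
(* The edge just crossed is seen reversed from the new corner; the others are parallel to edges at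
   the old corner and carry the same letters. *)
rewrite !corner_flip; have [->|lk] := eqVneq l k.
  rewrite -!reverse_out_edge /reverse !cmap_face -!/(reverse _) -cmap_face ew.
  by rewrite phi_rev cmap_face.
rewrite !cmap_face !parallel_out_edge // -!cmap_face ew phi_adj //.
by rewrite !cmap_face; apply: span_square_out_edge; rewrite eq_sym.
Qed.

(** The images of the axes pairwise span squares; flagness fills them with a cube of [S], which is
    lifted at [G (base c)]. *)
Lemma family_image_ex n (c : cell X n) : exists c' : cell X n, family_image c c'.
Proof.
have [phi_aut _ _] := compatibleE phi_compat.
have [[phi_bij phi_adj] [[axis_inj _] flag]] :=
  (phi_aut (base c), salvetti_npc S_salvetti).
have [||i j ij|d [_ dE]] := flag n (p _ (base c))
    (fun i => phi (base c) (p _ (axis c i))).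
- by move=> i j /(bij_inj phi_bij); rewrite !map_axis => /axis_inj.
- by move=> i; exact: salvetti_vertex.
- by rewrite phi_adj !map_axis !axisE; exact: span_square_out_edge.
exists (lift (G (base c)) d); split; first exact: base_lift.
by move=> i; rewrite map_axis map_lift dE.
Qed.

Lemma family_map : exists f : cube_map X X,
  (forall z, f _ z = G z) /\ forall e : cell X 1, p _ (f _ e) = phi (source e) (p _ e).
Proof.
pose f n (c : cell X n) := projT1 (cid (family_image_ex c)).
have fP n (c : cell X n) : family_image c (f n c) by rewrite /f; case: cid.
have f_face m n (t : face_map m n) (c : cell X n) : f m (face t c) = face t (f n c).
  have fc := family_image_corner (fP n c).
  have [bt at_] := fP _ (face t c); apply: (cell_eq S_salvetti p_universal).
    by rewrite bt !base_face (fc _).1.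
  move=> i; rewrite at_ base_face.
  have /eqP/mem_card1[k tk] := forallP (face_coordP t) i.
  have /eqP tki : (t k).1 == Some i by have := tk k; rewrite !inE eqxx.
  by rewrite !(axis_face _ tki) (fc _).2.
exists (CubeMap f_face); split=> [z|e] /=.
  by have [bz _] := fP _ z; rewrite -[LHS]base_vertex bz base_vertex.
by have [_ /(_ ord0)] := fP _ e; rewrite !axis_edge.
Qed.

End Family.

Lemma family_aut phi x y : compat phi -> exists g, [/\ g _ x = y,
  forall z a, g _ (move z a) = move (g _ z) (phi z a)
  & forall e : cell X 1, p _ (g _ e) = phi (source e) (p _ e)].
Proof.
move=> phi_compat; have [G [H [psi [Gx psi_compat GS HS [GK HK phiK psiK]]]]] :=
  @compatible_integral cover phi x y phi_compat.
have [f [fG fe]] := family_map phi_compat GS.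
have [f' [fH fe']] := family_map psi_compat HS.
have src (t : cube_map X X) (e : cell X 1) : source (t _ e) = t _ (source e).
  by rewrite /source /corner cmap_face.
have fK n : cancel (f n) (f' n).
  move=> c; apply: (cell_eq S_salvetti p_universal) => [|i].
    by rewrite /base /corner -!cmap_face fG fH GK.
  by rewrite /axis -!cmap_face fe' fe src fG phiK.
have fVK n : cancel (f' n) (f n).
  move=> c; apply: (cell_eq S_salvetti p_universal) => [|i].
    by rewrite /base /corner -!cmap_face fH fG HK.
  by rewrite /axis -!cmap_face fe fe' src fH psiK.
by exists (CubeAut fK fVK); split=> /= [|z a|//]; rewrite !fG ?GS.
Qed.

(** Both the link of [z] and that of its image are identified with the letters, so that actions at
    different vertices can be compared. *)
Definition link_action g z a : E := p _ (g _ (lift z a)).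

Lemma source_aut (t : cube_map X X) (e : cell X 1) : source (t _ e) = t _ (source e).
Proof. by rewrite /source /corner cmap_face. Qed.

Lemma map_aut g (e : cell X 1) : p _ (g _ e) = link_action g (source e) (p _ e).
Proof. by rewrite /link_action edgeE. Qed.

Lemma aut_lift g z a : g _ (lift z a) = lift (g _ z) (link_action g z a).
Proof.
apply: (edge_eq S_salvetti p_universal); last by rewrite map_lift.
by rewrite source_aut !source_lift.
Qed.

Lemma aut_move g z a : g _ (move z a) = move (g _ z) (link_action g z a).
Proof. by rewrite /move -aut_lift /target /corner cmap_face. Qed.

Lemma link_actionM g h z a :
  link_action (g * h)%g z a = link_action g (h _ z) (link_action h z a).
Proof. by rewrite {2}/link_action -aut_lift. Qed.

Lemma link_action1 z : link_action 1%g z = id.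
Proof. by apply/funext => a; rewrite /link_action /= map_lift. Qed.

Lemma link_action_adj g z a b : adj a b -> adj (link_action g z a) (link_action g z b).
Proof.
move=> ab; have [s [bs ls _ _]] := lift_square S_salvetti p_universal z ab.
exists (p _ (g _ s)); rewrite /link_action -bs -ls.
by rewrite /bottom_edge /left_edge !cmap_face.
Qed.

Lemma link_actionK g z : cancel (link_action g z) (link_action g^-1%g (g _ z)).
Proof. by move=> a; rewrite -link_actionM mulVg link_action1. Qed.

Lemma link_actionVK g z : cancel (link_action g^-1%g (g _ z)) (link_action g z).
Proof.
move=> a; have gz : g^-1%g _ (g _ z) = z by rewrite /= autK.
by rewrite -{1}gz -link_actionM mulgV link_action1.
Qed.

Lemma link_action_compat g : compat (link_action g).
Proof.
split=> [z|z a].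
  split.
    exists (link_action g^-1%g (g _ z)); [exact: link_actionK|exact: link_actionVK].
  move=> a b; split; last exact: link_action_adj.
  by move=> /(@link_action_adj g^-1%g (g _ z)); rewrite !link_actionK.
split=> [|b ab].
  rewrite /link_action /= lift_reverse /reverse !cmap_face //.
have [s [_ ls _ rs]] := lift_square S_salvetti p_universal z ab.
rewrite /link_action /= -ls -rs /left_edge /right_edge !cmap_face.
exact: salvetti_right.
Qed.

Definition agree_at g h z : Prop :=
  g _ z = h _ z /\ link_action g z = link_action h z.

Lemma agree_at_base g h n (c : cell X n) : agree_at g h (base c) -> g _ c = h _ c.
Proof.
have src i : source (axis c i) = base c by rewrite axisE source_out_edge.
move=> [gv gl]; apply: (cell_eq S_salvetti p_universal) => [|i].
  by rewrite /base /corner -!cmap_face.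
by rewrite /axis -!cmap_face -!/(axis c i) !map_aut src gl.
Qed.

(** A reflection of the cube moves the corner [w] to the base. *)
Lemma agree_at_corner g h n (c : cell X n) w :
  agree_at g h (corner c w) -> g _ c = h _ c.
Proof.
have refl_c (d : cell X n) : face (reflect_map w) (face (reflect_map w) d) = d.
  by rewrite -face_compE reflect_mapK face_idE.
have -> : corner c w = base (face (reflect_map w) c).
  by rewrite /base /corner -face_compE reflect_map_corner.
by move=> /agree_at_base; rewrite !cmap_face => /(congr1 (face (reflect_map w)));
   rewrite !refl_c.
Qed.

(** * The group Aut^+ and the hyperplanes of the universal cover *)

Lemma aut_plus_closed : group_closed [in (aut_plus X : set (cube_aut X))].
Proof.
split=> [|g h]; rewrite !inE.
  by move=> H [] [H1 _] _; move: H1; rewrite inE.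
move=> gA hA H HP; have [[_ Hd] _] := HP.
by have := Hd g h; rewrite !inE; apply; [exact: gA|exact: hA].
Qed.

Lemma aut_plus1 : aut_plus X 1%g.
Proof. by have [H _] := aut_plus_closed; rewrite inE in H. Qed.

Lemma aut_plusM g h : aut_plus X g -> aut_plus X h -> aut_plus X (g * h)%g.
Proof.
move=> gA hA; have := group_closedM aut_plus_closed (x := g) (y := h).
by rewrite !inE; apply.
Qed.

Lemma aut_plusV g : aut_plus X g -> aut_plus X g^-1%g.
Proof.
by move=> gA; have := group_closedV aut_plus_closed (x := g); rewrite !inE; apply.
Qed.

Lemma wall_hyperplane y s z a : wall (z : vert cover) a = wall (y : vert cover) s ->
  hyperplane (lift y s) (lift z a).
Proof.
have ladder_par t : @ladder cover s y t -> oparallel (lift y s) (lift t s).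
  move: t; apply: (@ladder_ind cover s (fun t => oparallel (lift y s) (lift t s))).
    exact: rst_refl.
  move=> t b sb yt; apply: rst_trans yt (rst_step _ _ _ _ _).
  have [q [bq _ tq _]] := lift_square S_salvetti p_universal t sb.
  by exists q.
move=> /esym/wall_inv[[-> /ladder_par]|[-> /ladder_par]]; first by left.
by right; rewrite -lift_reverse reverseK.
Qed.

(** A path avoiding the hyperplane keeps its colour, and [move y s] already has the colour of the
    far side. *)
Lemma side_separates y s z : side (hyperplane (lift y s)) (move y s) z ->
  @separates cover (wall (y : vert cover) s) y z.
Proof.
have [F [Fy FS FW]] := colouring (wall (y : vert cover) s) y.
move=> [q [qz qH]]; apply/(separatesP Fy FW).
have : F (move y s) by rewrite [F _]FS Fy eqxx.
elim: q (move y s) qz qH => [t <- //|e q IH t [et qz] qH Ft].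
apply: IH qz (List.Forall_inv_tail qH) _.
have eH := List.Forall_inv qH; rewrite -(move_source S_salvetti p_universal).
rewrite [F _]FS et Ft; case: eqP => // /wall_hyperplane.
by rewrite -et edgeE => /eH.
Qed.

(** One letter [s0] of [D] exhibits a halfspace fixed pointwise, which puts [h] in Aut^+; the whole
    of [D] records where [h] is trivial. *)
Lemma aut_plus_family (D : set E) y (f : E -> E) : link_aut f ->
  (exists s, D s) -> (forall s, D s -> @fixes_star cover f s) ->
  exists h, [/\ aut_plus X h, h _ y = y, link_action h y = f
    & forall z s, D s -> @separates cover (wall (y : vert cover) s) y z ->
        agree_at h 1%g z].
Proof.
move=> f_aut [s0 Ds0] fD.
have [psi [psi_compat psiy psi_out psi_fix]] := @halfspace_family cover D f y f_aut fD.
have [h [hy hS he]] := family_aut y y psi_compat.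
have hl z : link_action h z = psi z.
  by apply/funext => a; rewrite /link_action he source_lift map_lift.
have h_out z s : D s -> @separates cover (wall (y : vert cover) s) y z ->
    agree_at h 1%g z.
  move=> Ds sz; split; first exact: (psi_fix (fun z => h _ z)) sz.
  by rewrite hl link_action1 (psi_out z s).
exists h; split=> //; last by rewrite hl.
move=> H [_]; apply; exists (side (hyperplane (lift y s0)) (move y s0)).
  by exists (hyperplane (lift y s0)), (move y s0); split=> //; exists (lift y s0).
move=> n c cs; have := @agree_at_base h 1%g n c; apply.
by apply: (h_out _ s0) => //; apply/side_separates/cs.
Qed.

End SalvettiAut.

(** * Approximation by elements fixing a halfspace *)

Section FiniteIndex.
Variables (S X : cube_complex) (p : cube_map X S).
Hypothesis S_salvetti : salvetti S.
Hypothesis p_universal : universal_covering p.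
Local Notation V := (cell X 0).
Local Notation E := (cell S 1).
Local Notation cover := (salvetti_cover S_salvetti p_universal).
Local Notation lift := (lift S_salvetti p_universal).
Local Notation move := (move S_salvetti p_universal).
Local Notation adj := (@span_square S).
Local Notation link_aut := (graph_automorphism adj).
Local Notation link_action := (link_action S_salvetti p_universal).
Local Notation agree_at := (agree_at S_salvetti p_universal).
Local Notation vball := (@ball cover).
Implicit Types (x y z : V) (a b : E) (f g h k : cube_aut X).

Lemma agree_atM f g h k z : agree_at f g (h _ z) -> agree_at h k z ->
  agree_at (f * h)%g (g * k)%g z.
Proof.
move=> [fv fl] [hv hl]; split; first by rewrite /= fv hv.
by apply/funext => a; rewrite !link_actionM fl hl hv.
Qed.

Lemma agree_at_trans f g h z : agree_at f g z -> agree_at g h z -> agree_at f h z.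
Proof. by move=> [fv fl] [gv gl]; split; [rewrite fv|rewrite fl]. Qed.

Lemma agree_at_sym f g z : agree_at f g z -> agree_at g f z.
Proof. by move=> [fv fl]. Qed.

Lemma ballS x n z : vball x n.+1 z ->
  vball x n z \/ exists z' a, vball x n z' /\ z = move z' a.
Proof.
move=> [w]; case/lastP: w => [|w a]; first by left; exists [::].
rewrite size_rcons ltnS foldl_rcons => wn <-; right.
by exists (foldl move x w), a; split=> //; exists w.
Qed.

Lemma aut_ball g x n : exists m, forall z, vball x n z -> vball x m (g _ z).
Proof.
have [u ux] := walk_connected S_salvetti p_universal x (g _ x).
exists (size u + n)%N; elim: n => [|n IH] z.
  by move=> [[|//] _ <-]; exists u; rewrite ?addn0.
case/ballS=> [/IH|[z' [a [/IH gz' ->]]]].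
  by apply: ball_leq; rewrite leq_add2l.
by rewrite aut_move addnS; exact: (@ball_step cover).
Qed.

Hypothesis E_finite : exists s : seq {classic E}, forall a : {classic E}, a \in s.

Lemma ball_finite x n : exists s : seq {classic V},
  forall z, vball x n z -> (z : {classic V}) \in s.
Proof.
have [es esP] := E_finite.
elim: n => [|n [s sP]]; first by exists [:: x] => z [[|//] _ <-]; rewrite inE.
pose mv (z : {classic V}) (a : {classic E}) : {classic V} := move z a.
exists (s ++ [seq mv z a | z <- s, a <- es]) => z.
rewrite mem_cat; case/ballS=> [/sP ->//|[z' [a [/sP z's ->]]]].
by apply/orP; right; apply: (allpairs_f mv).
Qed.

(** Induction on the radius. The vertices of the new sphere are treated one at a time, each by a
    correction that is trivial on the rest of the ball. *)
Lemma aut_plus_approx g x n : agree_at g 1%g x ->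
  exists2 h, aut_plus X h & forall z, vball x n z -> agree_at g h z.
Proof.
move=> gx; elim: n => [|n [h0 h0A h0P]].
  by exists 1%g; [exact: aut_plus1|move=> z [[|//] _ <-]].
suff main : forall s : seq {classic V}, exists2 h, aut_plus X h &
    forall z, vball x n z \/ (z : {classic V}) \in s /\ vball x n.+1 z ->
    agree_at g h z.
  have [s sP] := ball_finite x n.+1; have [h hA hP] := main s.
  by exists h => // z zn; apply: hP; right; split=> //; exact: sP.
elim=> [|y l [h hA hP]]; first by exists h0 => // z [/h0P|[]].
have [yn|yn] := pselect (vball x n y).
  exists h => // z [zn|[]]; first by apply: hP; left.
  by rewrite inE => /orP[/eqP->|zs] zn; apply: hP; [left|right].
have [ySn|ySn] := pselect (vball x n.+1 y); last first.
  exists h => // z [zn|[]]; first by apply: hP; left.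
  by rewrite inE => /orP[/eqP->//|zs] zn; apply: hP; right.
(* [k] is the error of the approximation [h]; it is trivial wherever [h] already agrees with [g]. *)
pose k := (h^-1 * g)%g.
have k1 z : agree_at g h z -> agree_at k 1%g z.
  by rewrite /k -(mulVg h) => gh; apply: agree_atM.
pose D s := vball x n (move y s).
have [/= k_aut k_rev k_adj] :=
  compatibleE (link_action_compat S_salvetti p_universal k).
(* Compatibility along the edge back to the smaller ball carries the triviality of [k] at [move y s]
   over to the star of [s] at [y]. *)
have Dstar s : D s -> k _ y = y /\ @fixes_star cover (link_action k y) s.
  move=> ys; have [kz lz] : agree_at k 1%g (move y s) by apply/k1/hP; left.
  have yE : y = move (move y s) (reverse s) by rewrite moveK.
  have lk : link_action k (move y s) = id by rewrite lz link_action1.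
  split; first by rewrite {1}yE aut_move kz lk /= moveK.
  split=> [|b /(@adj_barl cover) sb].
    by have := k_rev (move y s) (reverse s); rewrite -yE reverseK lk reverseK.
  by have := k_adj (move y s) _ _ sb; rewrite -yE lk.
have [//|[y' [a [y'n yE]]]] := ballS ySn.
have Da : D (reverse a) by rewrite /D yE moveK.
have [ky _] := Dstar _ Da.
have [f [fA fy fl f1]] := aut_plus_family y (k_aut y) (ex_intro D _ Da)
  (fun s Ds => (Dstar s Ds).2).
exists (h * f)%g => [|z zs]; first exact: aut_plusM.
have [->|zy] := pselect (z = y).
  have -> : g = (h * k)%g by rewrite /k mulVKg.
  by apply: agree_atM => //; split; rewrite ?ky ?fy ?fl.
have hz : agree_at g h z.
  apply: hP; case: zs => [|[]]; first by left.
  by rewrite inE => /orP[/eqP//|] ? ?; right.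
have zn : vball x n.+1 z.
  by case: zs => [|[]//]; apply: ball_leq.
(* A hyperplane dual to an edge leading back from [y] separates [z] from [y], so that the correction
   [f] does not disturb [z]. *)
have [s Ds /(f1 _ _ Ds) fz] := @sphere_separated cover x n y z ySn yn zn zy.
apply: agree_at_trans hz _; rewrite -{1}(mulg1 h); apply: agree_atM => //.
exact: agree_at_sym.
Qed.

Hypothesis E_flexible : flexibly_vertex_transitive adj.

Lemma aut_plus_link_transitive y a b :
  exists2 h, aut_plus X h & h _ y = y /\ link_action h y a = b.
Proof.
have [u [f [f_aut fu fn fa]]] := E_flexible a b.
have [||h [hA hy hl _]] :=
  @aut_plus_family _ _ _ S_salvetti p_universal [set u] y f f_aut.
- by exists u.
- by move=> _ ->.
by exists h => //; rewrite hl.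
Qed.

Definition near_vertex x (o : option E) : V := if o is Some a then move x a else x.

Lemma aut_plus_orbits x z : exists h o, aut_plus X h /\ h _ (near_vertex x o) = z.
Proof.
elim/(@vert_ind cover x): z => [|z b [h [[a|] [hA hz]]]].
- by exists 1%g, None; split=> //; exact: aut_plus1.
(* A rotation about [move x a] turns the edge back to [x] into the one that [h] sends to the edge
   [b] at [z]; so the next vertex is in the orbit of [x]. *)
- pose b' := link_action h^-1%g (h _ (move x a)) b.
  have [k kA [kx kb]] := aut_plus_link_transitive (move x a) (reverse a) b'.
  exists (h * k)%g, None; split; first exact: aut_plusM.
  rewrite /= -{1}(moveK S_salvetti p_universal x a) aut_move kx kb aut_move.
  by rewrite /b' link_actionVK -/(near_vertex x (Some a)) hz.
- exists h, (Some (link_action h^-1%g (h _ x) b)); split=> //.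
  by rewrite /= aut_move link_actionVK -[h _ x]/(h _ (near_vertex x None)) hz.
Qed.

(** [H] stands for the closure, of which only two facts are used: it contains limits taken over
    balls, and a left translation mapping Aut^+ into it maps all of it into itself. *)
Lemma finite_index_closed x (H : set (cube_aut X)) :
  (forall g, (forall n, exists2 h, aut_plus X h &
     forall z, vball x n z -> agree_at g h z) -> H g) ->
  (forall g, (forall h, aut_plus X h -> H (g * h)%g) ->
     forall h, H h -> H (g * h)%g) ->
  finite_index H.
Proof.
move=> H_approx H_mul.
have H_plus g : aut_plus X g -> H g by move=> gA; apply: H_approx => n; exists g.
(* To approximate [g * h] on a ball, [g] is approximated on a larger ball containing the image of
   the first under [h]. *)
have H_fix g h : agree_at g 1%g x -> H h -> H (g * h)%g.
  move=> gx; apply: H_mul => {}h hA; apply: H_approx => n.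
  have [m hm] := aut_ball h x n; have [k kA kg] := aut_plus_approx m gx.
  exists (k * h)%g; first exact: aut_plusM.
  by move=> z /hm/kg gk; apply: agree_atM.
have H_plusM g h : aut_plus X g -> H h -> H (g * h)%g.
  by move=> gA; apply: H_mul => {}h hA; apply: H_plus; apply: aut_plusM.
pose coset g := [set (g * h)%g | h in H].
(* Here [g] is [g' * k'], times an element fixing the star of [x], times [k^-1]. *)
have coset_sub g k g' k' : aut_plus X k -> aut_plus X k' ->
    agree_at (g * k)%g (g' * k')%g x -> coset g `<=` coset g'.
  move=> kA k'A gx _ [h Hh <-].
  exists (k' * (((g' * k')^-1 * (g * k)) * (k^-1 * h)))%g; last first.
    by rewrite mulgA -(mulgA (g' * k')^-1%g) mulVKg -mulgA mulVKg.
  apply: (H_plusM _ _ k'A); apply: H_fix; last first.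
    by apply: H_plusM => //; exact: aut_plusV.
  by rewrite -(mulVg (g' * k')%g); apply: agree_atM.
have [es esP] := E_finite.
pose n := size es; have idx_lt a : index (a : {classic E}) es < n by rewrite index_mem.
pose code a : 'I_n := Ordinal (idx_lt a).
pose decode (i : 'I_n) : E := tnth (in_tuple es) i.
have codeK : cancel code decode.
  by move=> a; rewrite /decode (tnth_nth a); apply: (@nth_index {classic E}).
(* Codes for the image of [x] and the link action there, with letters replaced by their positions in
   [es] to get a finite type. *)
pose T := (option 'I_n * {ffun 'I_n -> 'I_n})%type.
pose coded g (t : T) := exists k, [/\ aut_plus X k,
  (g * k)%g _ x = near_vertex x (omap decode t.1)
  & link_action (g * k)%g x = decode \o t.2 \o code].
have coded_ex g : exists t, coded g t.
  (* [g * k] sends [x] or a neighbour of [x] to [x], hence [x] to itself or to a neighbour. *)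
  have [k [d [kA kx]]] := aut_plus_orbits x (g^-1%g _ x).
  have [c cx] : exists c, (g * k)%g _ x = near_vertex x c.
    case: d kx => [a|] kx; last by exists None; rewrite /= kx /= autVK.
    pose a' := link_action (g * k)%g (move x a) (reverse a).
    exists (Some a'); rewrite -{1}(moveK S_salvetti p_universal x a) aut_move.
    by rewrite /a' /= kx /= autVK.
  exists (omap code c, [ffun i => code (link_action (g * k)%g x (decode i))]), k.
  split=> //; first by rewrite cx; case: (c) => //= b; rewrite codeK.
  by apply/funext => a; rewrite /= ffunE !codeK.
have coded_coset g g' t : coded g t -> coded g' t -> coset g = coset g'.
  move=> [k [kA kx kl]] [k' [k'A kx' kl']].
  by apply/seteqP; split; [apply: (@coset_sub g k g' k')|apply: (@coset_sub g' k' g k)];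
     rewrite // /agree_at kx kx' kl kl'.
(* The value 1 is a default for codes that do not occur. *)
pose rep t := if pselect (exists g, coded g t) is left ex then projT1 (cid ex) else 1%g.
have repP g t : coded g t -> coded (rep t) t.
  by rewrite /rep; case: pselect => [ex _|nex ct]; [case: cid | case: nex; exists g].
apply: (@sub_finite_set _ _ [set coset (rep t) | t in [set: T]]).
  move=> _ [g _ <-]; have [t gt] := coded_ex g.
  by exists t => //; apply: coded_coset (repP _ _ gt) gt.
exact/finite_image/finite_finset.
Qed.

End FiniteIndex.

(** * The compact-open topology *)

Section CompactOpen.
Local Open Scope ring_scope.
Variables (R : realType) (X : cube_complex).
Implicit Types (v : cell X 0) (g h : cube_aut X) (A : set (cube_aut X)).

(** The open star of [v]: [(~~ w k)%:R] is the coordinate of the facet opposite to the corner [w].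
    Several corners of a cube may be glued to [v], whence the quantifier over [w]. *)
Definition in_star v (x : cubes_union R X) : Prop :=
  exists2 w, corner (projT2 (projT1 x)) w = v &
    forall k, set_val (projT2 x) ord0 k != (~~ w k)%:R.

Lemma in_star_glue v (x y : cubes_union R X) :
  Defs.glue x y -> in_star v x <-> in_star v y.
Proof.
move=> [m [n [f [c [t [s [st -> ->]]]]]]]; rewrite /in_star /= st.
split=> -[w cw wt].
- exists (fun k => if (f k).1 is Some i then (f k).2 (+) w i else (f k).2).
    rewrite -cw /corner -face_compE; congr face.
    apply/val_inj/ffunP => k; rewrite !ffunE /comp_coord.
    by case: (f k) => -[i|] b //=; rewrite ffunE addbC.
  move=> k; rewrite mxE; case: (f k) => -[i|] b /=; last first.
    by case: b; rewrite /= ?oner_eq0 // eq_sym oner_eq0.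
  case: b => /=; last exact: wt.
  have := wt i; case: (w i) => /=; apply: contra => /eqP e; apply/eqP.
    by rewrite -[LHS](subKr 1) e subrr.
  by rewrite -[LHS](subKr 1) e subr0.
- have /choice[k fk] : forall i : 'I_m, exists k, (f k).1 = Some i.
    move=> i; have /eqP/mem_card1[k fk] := forallP (face_coordP f) i.
    by exists k; apply/eqP; have := fk k; rewrite !inE eqxx.
  have kf l i : (f l).1 = Some i -> l = k i.
    move=> fl; have /eqP/mem_card1[k' fk'] := forallP (face_coordP f) i.
    by have := fk' l; have := fk' (k i); rewrite !inE fl fk eqxx;
       move=> /esym/eqP-> /esym/eqP->.
  exists (fun i => (f (k i)).2 (+) w (k i)).
    rewrite -cw /corner -face_compE; congr face.
    apply/val_inj/ffunP => l; rewrite !ffunE /comp_coord.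
    case fl: (f l).1 => [i|]; rewrite ?ffunE /=.
      by rewrite -(kf _ _ fl) addbC addbA addbb.
    (* A coordinate that is constant on the face avoids the value opposite to [w l], so it equals
       [w l] and the corner lies on the face. *)
    congr pair; have := wt l; rewrite mxE fl.
    by case: (f l).2; case: (w l); rewrite //= eqxx.
  move=> i; have := wt (k i); rewrite mxE fk.
  case: (f (k i)).2; case: (w (k i)) => //=; apply: contra => /eqP ->; apply/eqP.
    by rewrite subrr.
  by rewrite subr0.
Qed.

Lemma in_star_glued v (x y : cubes_union R X) :
  glued x y -> in_star v x <-> in_star v y.
Proof.
move/asboolP; elim=> {x y} [x y /in_star_glue//|//|x y _ IH|x y z _ IH1 _ IH2].
  by rewrite IH.
by rewrite IH1 IH2.
Qed.

Definition open_star v : set (realization R X) :=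
  [set q | in_star v (repr (q : {eq_quot (@glued_equiv R X)}%qT))].

Lemma open_star_class v x : open_star v (point_class x) <-> in_star v x.
Proof.
apply: in_star_glued.
have : (repr (\pi_({eq_quot (@glued_equiv R X)}) x) =
        x %[mod {eq_quot (@glued_equiv R X)}])%qT by rewrite reprK.
by move/eqquotP.
Qed.

Lemma open_open_star v : open (open_star v).
Proof.
rewrite /open /= /quotient_open.
have -> : \pi_(quotient_topology {eq_quot (@glued_equiv R X)})%qT @^-1` open_star v
    = [set x | in_star v x].
  by apply/seteqP; split=> x /open_star_class.
apply/sigT_openP => -[n c].
have -> : existT (fun c : cubes X => unit_cube R (projT1 c)) (existT (cell X) n c)
    @^-1` [set x | in_star v x] =
  \bigcup_(w in [set w | corner c w = v])
    [set t : unit_cube R n | forall k, set_val t ord0 k != (~~ w k)%:R].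
  by apply/seteqP; split=> t /= [w cw wt]; exists w.
apply: bigcup_open => w _.
change (open [set t : unit_cube R n | forall k, set_val t ord0 k != (~~ w k)%:R]).
rewrite openE => t /= wt.
change (nbhs t [set t : unit_cube R n | forall k, set_val t ord0 k != (~~ w k)%:R]).
suff tk : forall k, nbhs t [set t : unit_cube R n | set_val t ord0 k != (~~ w k)%:R].
  exact: (filter_forall _ tk).
move=> k.
have tk : continuous (fun t : unit_cube R n => set_val t ord0 k).
  move=> s; apply: (@continuous_comp _ _ _ (set_val : unit_cube R n -> 'rV[R]_n)
    (fun M : 'rV[R]_n => M ord0 k)).
    exact: initial_continuous.
  exact: coord_continuous.
apply: open_nbhs_nbhs; split; last exact: wt.
have := @open_comp _ R (fun t : unit_cube R n => set_val t ord0 k) _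
  (fun s _ => tk s) (@open_neq R (~~ w k)%:R).
by [].
Qed.

Lemma open_star_cover q : exists v, open_star v q.
Proof.
set x := repr (q : {eq_quot (@glued_equiv R X)}%qT).
(* Rounding every non-zero coordinate to 1 gives a corner whose opposite values are all avoided. *)
pose w k := set_val (projT2 x) ord0 k != 0.
exists (corner (projT2 (projT1 x)) w), w => // k.
rewrite {}/w; move: (fun_of_matrix _ _ _) => s; have [->|//] := eqVneq s 0.
by rewrite eq_sym oner_eq0.
Qed.

Definition agree_on_star g h v : Prop :=
  forall n (c : cell X n) w, corner c w = v -> g _ c = h _ c.

Lemma aut_realization_star g h v q : agree_on_star g h v -> open_star v q ->
  aut_realization g q = aut_realization h q.
Proof. by move=> gh [w cw _]; rewrite /aut_realization /aut_point (gh _ _ w). Qed.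

(** Open stars cover the realization, and agreement on the star of a vertex gives equality on its
    open star; a compact set is thus controlled by finitely many vertices. *)
Lemma aut_closure_approx A g :
  (forall s : seq (cell X 0), exists2 h, A h &
     forall v, List.In v s -> agree_on_star h g v) ->
  aut_closure R A g.
Proof.
move=> gA.
pose F := filter_from [set: seq (cell X 0)] (fun s =>
  [set h | A h /\ forall v, List.In v s -> agree_on_star h g v]).
have FF : ProperFilter F.
  apply: filter_from_proper; last by move=> s _; have [h hA hP] := gA s; exists h.
  apply: filter_from_filter; first by exists [::].
  move=> s t _ _; exists (s ++ t) => // h [hA hP].
  by split; split=> // v vs; apply: hP; apply/List.in_app_iff; [left|right].
have FA : F A by exists [::] => // h [].
have Fcvg : (@aut_realization R X) @ F --> aut_realization g.
  apply/compact_open_cvgP => K O cK _ gKO.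
  suff : F [set h | K `<=` [set q | aut_realization h q = @aut_realization R X g q]].
    apply: filterS => h hK _ [q Kq <-].
    by rewrite [X in O X]hK //; apply: gKO; exists q.
  (* In its near-covering form, compactness makes an equality that holds eventually near each point
     hold eventually on all of [K]. *)
  have /compact_near_coveringP cK' := cK.
  apply: (cK' _ F (fun h q => aut_realization h q = @aut_realization R X g q)) => q _.
  have [v qv] := open_star_cover q.
  exists (open_star v, [set h | agree_on_star h g v]).
    split; first by apply: open_nbhs_nbhs; split=> //; exact: open_open_star.
    by exists [:: v] => // h [_]; apply; left.
  by move=> [r h] /= [rv hv]; exact: (aut_realization_star hv rv).
move=> B; rewrite nbhsE => -[B' [[U oU UB'] B'g] B'B].
have : F (@aut_realization R X @^-1` U).
  by apply: Fcvg; apply: open_nbhs_nbhs; split=> //; rewrite -UB' in B'g.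
by rewrite UB' => FB'; have [h [hA hB]] := filter_ex (filterI FA FB');
   exists h; split=> //; exact: B'B.
Qed.

Lemma aut_realization_continuous g : continuous (@aut_realization R X g).
Proof.
apply/quotient_continuous.
have -> : @aut_realization R X g \o
      \pi_(quotient_topology {eq_quot (@glued_equiv R X)})%qT =
    \pi_(quotient_topology {eq_quot (@glued_equiv R X)})%qT \o @aut_point R X g.
  by apply/funext => x; exact: aut_realizationE.
move=> x; apply: continuous_comp; last exact: pi_continuous.
have -> : @aut_point R X g = unstable.sigT_fun (fun c : cubes X =>
    existT (fun c : cubes X => unit_cube R (projT1 c))
      (existT (cell X) (projT1 c) (g _ (projT2 c)))).
  by apply/funext => -[[n c] t].
apply: sigT_continuous => c.
exact: (@existT_continuous _ (fun c : cubes X => unit_cube R (projT1 c))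
  (existT (cell X) (projT1 c) (g _ (projT2 c)))).
Qed.

Lemma aut_realizationM g h q :
  @aut_realization R X (g * h)%g q = aut_realization g (aut_realization h q).
Proof. by rewrite {3}/aut_realization aut_realizationE. Qed.

(** The condition that [g * h] maps [K] into [O] says that [h] maps [K] into the preimage of [O]
    under [g], which is open. *)
Lemma aut_mul_continuous g :
  continuous (fun h : aut_space R X => (g * h)%g : aut_space R X).
Proof.
apply: continuous_comp_initial => h.
have FF := fmap_filter (fun h' : aut_space R X => aut_realization (g * h')%g :
  {compact-open, realization R X -> realization R X})
  (nbhs_filter (h : aut_space R X)).
apply/(compact_open_cvgP _ FF) => K O cK oO ghKO.
have oO' : open (@aut_realization R X g @^-1` O).
  by apply: open_comp => // q _; exact: aut_realization_continuous.
have hKO' : [set h' : aut_space R X |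
    @aut_realization R X h' @` K `<=` aut_realization g @^-1` O] h.
  by move=> _ [q Kq <-] /=; rewrite -aut_realizationM; apply: ghKO; exists q.
have nK : nbhs (h : aut_space R X)
    [set h' : cube_aut X | @aut_realization R X h' @` K `<=` aut_realization g @^-1` O].
  exact: (@initial_continuous _ _ (@aut_realization R X) h _
    (open_nbhs_nbhs (conj (compact_open_open cK oO') hKO'))).
change (nbhs (h : aut_space R X)
  [set h' : cube_aut X | aut_realization (g * h')%g @` K `<=` O]).
apply: (filterS _ nK) => h' h'K _ [q Kq <-].
by rewrite [X in O X]aut_realizationM; apply: h'K; exists q.
Qed.

Lemma aut_closure_mul A g h : (forall a, A a -> aut_closure R A (g * a)%g) ->
  aut_closure R A h -> aut_closure R A (g * h)%g.
Proof.
move=> gA Ah; rewrite /aut_closure (closure_id (closure _)).1;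
  last exact: closed_closure.
move=> B /aut_mul_continuous/Ah[a [aA Ba]].
by exists (g * a)%g; split=> //; exact: gA.
Qed.

End CompactOpen.

(** * Letters as vertices of links *)

Lemma compact_finite_edges (S : cube_complex) : compact_complex S ->
  exists s : seq {classic (cell S 1)}, forall a : {classic (cell S 1)}, a \in s.
Proof.
move=> S_fin; have : finite_set [set: {classic (cell S 1)}].
  rewrite -(preimage_setT (fun a => existT (cell S) 1%N a)).
  apply: finite_preimage S_fin => a b _ _; exact: existT_inj2.
move=> /finite_seqP[s sE]; exists s => a.
by have : [set: {classic (cell S 1)}] a by []; rewrite sE.
Qed.

Section LinkLetters.
Variables (S X : cube_complex) (p : cube_map X S).
Hypothesis S_salvetti : salvetti S.
Hypothesis p_universal : universal_covering p.

Lemma span_square_map (e e' : cell X 1) : source e = source e' ->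
  span_square (p _ e) (p _ e') <-> span_square e e'.
Proof.
move=> ee'; split=> [|[s [<- <-]]]; last first.
  by exists (p _ s); rewrite /bottom_edge /left_edge !cmap_face.
move=> /(lift_square S_salvetti p_universal (source e))[s [bs ls _ _]].
by exists s; rewrite bs ls {2}ee' !edgeE.
Qed.

(** Lifting at [x] identifies the graph of letters with the 1-skeleton of the link, and
    automorphisms are conjugated by this identification. *)
Lemma letters_flexible (x : cell X 0) : flexibly_vertex_transitive (link_adj x) ->
  flexibly_vertex_transitive (@span_square S).
Proof.
move=> flex.
pose edge a : link_vertex x := exist _ (lift S_salvetti p_universal x a)
  (source_lift S_salvetti p_universal x a).
pose label (e : link_vertex x) := p _ (proj1_sig e).
have edgeK : cancel edge label by move=> a; exact: map_lift.
have labelK : cancel label edge.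
  by move=> [e ex]; apply: eq_exist; rewrite /label /= -ex; exact: edgeE.
have adjE (e e' : link_vertex x) : span_square (label e) (label e') <-> link_adj x e e'.
  by apply: span_square_map; case: e e' => [e ex] [e' e'x] /=; rewrite ex.
move=> v w; have [u [f [[f_bij f_adj] fu fn fv]]] := flex (edge v) (edge w).
exists (label u), (label \o f \o edge); split=> /=.
- split; last by move=> a b; rewrite /= adjE f_adj -adjE !edgeK.
  by apply: bij_comp; [apply: bij_comp f_bij; exists edge | exists label].
- by rewrite labelK fu.
- by move=> n un; rewrite fn ?edgeK // -adjE edgeK.
- by rewrite fv edgeK.
Qed.

End LinkLetters.

Theorem theorem8 (R : realType) (S X : cube_complex) (p : cube_map X S)
    (x : cell X 0)
    (S_compact : compact_complex S)
    (S_connected : connected_complex S)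
    (S_npc : nonpositively_curved S)
    (S_special : special S)
    (p_universal : universal_covering p)
    (deck_transitive : vertex_transitive (deck_group p))
    (link_flexible : flexibly_vertex_transitive (link_adj x)) :
  finite_index (aut_closure R (aut_plus X)).
Proof.
have S_salvetti : salvetti S.
  apply: (special_salvetti S_connected S_npc S_special p_universal.2 deck_transitive).
  by exists x.
apply: (@finite_index_closed S X p S_salvetti p_universal _ _ x).
- exact: compact_finite_edges.
- exact: (letters_flexible S_salvetti p_universal link_flexible).
- move=> g g_approx; apply: aut_closure_approx => s.
  (* Finitely many vertices lie in a common ball, on which [g] is approximated. *)
  have [n ns] : exists n, forall v, List.In v s ->
      @ball (salvetti_cover S_salvetti p_universal) x n v.
    elim: s => [|v s [n ns]]; first by exists 0%N.
    have [w wv] := walk_connected S_salvetti p_universal x v.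
    exists (maxn (size w) n) => u [<-|/ns].
      by exists w => //; exact: leq_maxl.
    by apply: ball_leq; exact: leq_maxr.
  have [h hA hP] := g_approx n; exists h => // v /ns/hP hv m c w cw.
  apply/esym; have := @agree_at_corner S X p S_salvetti p_universal g h m c w.
  by rewrite cw; apply.
- by move=> g gA h; apply: aut_closure_mul.
Qed.
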